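(* Let $p,q\in(0,1/2)$ and let $(X_1,X_2,Y)$ be binary random variables, each $\mathrm{Bern}(1/2)$, with $X_2-X_1-Y$ a Markov chain, such that $X_1=X_2\oplus Z$ with $Z\sim\mathrm{Bern}(q)$ independent of $X_2$, and $Y=X_1\oplus W$ with $W\sim\mathrm{Bern}(p)$ independent of $(X_1,X_2)$. Then the relevance-rate function with side information only at the decoder is $$\mu_{\text{TW-CIB}}^{\text{D}}(R)=\begin{cases} 1-h_2(p\ast q)+\dfrac{f\left(g^{-1}(R_c)\right)}{R_c}R, & 0\leq R\leq R_c,\\[2mm] 1-h_2(p\ast q)+f\left(g^{-1}(R)\right), & R_c<R\leq h_2(q),\\[1mm] 1-h_2(p), & R>h_2(q), \end{cases}$$ where $R_c\in(0,h_2(q))$ is given by $$\frac{f'\left(g^{-1}(R_c)\right)}{g'\left(g^{-1}(R_c)\right)}=\frac{f\left(g^{-1}(R_c)\right)}{R_c}.$$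
   Context: All logarithms are base 2. $h_2(\cdot)$ is the binary entropy function; $a\ast b=a(1-b)+b(1-a)$; $\oplus$ is addition modulo 2. For $r\in[0,1]$, \begin{align*} g(r)&=h_2(r\ast q)-h_2(r),\\ f(r)&=h_2(r\ast q)-(1-p\ast q)\,h_2\!\left(r\ast\tfrac{pq}{1-p\ast q}\right)-(p\ast q)\,h_2\!\left(r\ast\tfrac{p(1-q)}{p\ast q}\right). \end{align*} Both functions are symmetric about $r=1/2$; $g^{-1}:[0,h_2(q)]\to[0,1/2]$ denotes the inverse of the restriction of $g$ to $[0,1/2]$. Let $(X_1^n,X_2^n,Y^n)$ be $n$ i.i.d. copies of $(X_1,X_2,Y)$. Here the encoder observes only $X_1^n$ and the decoder observes $X_2^n$. A pair $(R,\mu)\in\mathbb{R}_{\geq0}^2$ is achievable if for every $\varepsilon>0$ there is $n_0(\varepsilon)$ such that for all $n>n_0(\varepsilon)$ there are a finite set $\mathcal{I}$ and a map $\phi:\{0,1\}^n\to\mathcal{I}$ with $\frac1n\log|\mathcal{I}|\leq R+\varepsilon$ and, with $I=\phi(X_1^n)$, $\frac1nI(Y^n;I\,X_2^n)\geq\mu-\varepsilon$. The set of achievable pairs is $\mathcal{R}_{\text{TW-CIB}}^{\text{D}}(1/2)$, and $\mu_{\text{TW-CIB}}^{\text{D}}(R)=\sup\{\mu:(R,\mu)\in\mathcal{R}_{\text{TW-CIB}}^{\text{D}}(1/2)\}$.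
   Formalization: The existence of R_c is not claimed, since it fails for some p, q (e.g. p = q = 2/5, where f/g is strictly monotone): the first two cases are proved for every R_c in (0, h_2(q)) satisfying the equation, the third case for all p, q. *)

(* Defs.v *)
From mathcomp Require Import all_boot all_order all_algebra.
From mathcomp Require Import all_classical all_reals all_analysis.

Set Implicit Arguments.
Unset Strict Implicit.
Unset Printing Implicit Defensive.

Import Order.TTheory GRing.Theory Num.Theory.
Import numFieldNormedType.Exports.

Local Open Scope classical_set_scope.
Local Open Scope ring_scope.

Section RandomVariables.
Context {R : realType} {d : measure_display} {T : measurableType d}.
Context (P : probability T R).

Definition bernoulli_rv (p : R) (X : {RV P >-> bool}) : Prop :=
  distribution P X =1 bernoulli_prob p.

Definition independent_rv {d1 d2 : measure_display}
    {T1 : measurableType d1} {T2 : measurableType d2}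
    (X : T -> T1) (Y : T -> T2) : Prop :=
  forall A B, measurable A -> measurable B ->
    P (X @^-1` A `&` Y @^-1` B) = (P (X @^-1` A) * P (Y @^-1` B))%E.

(* X - Y - Z for discrete variables: P(x,y,z) P(y) = P(x,y) P(y,z), which is
   P(x,z|y) = P(x|y) P(z|y) without division. *)
Definition markov_chain {A B C : Type} (X : T -> A) (Y : T -> B) (Z : T -> C)
    : Prop :=
  forall a b c,
    (P [set w | [/\ X w = a, Y w = b & Z w = c]] * P [set w | Y w = b] =
     P [set w | X w = a /\ Y w = b] * P [set w | Y w = b /\ Z w = c])%E.

(* Coordinates of a letter are ordered (x1, x2, y). *)
Definition joint_pmf (X1 X2 Y : T -> bool) (x : bool * bool * bool) : R :=
  fine (P [set w | (X1 w, X2 w, Y w) = x]).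

End RandomVariables.

Section Information.
Context {R : realType}.

Definition log2 (x : R) : R := ln x / ln 2.

(* [ln 0 = 0], so 0 log 0 = 0 here and in [mutual_info]. *)
Definition h2 (x : R) : R := - (x * log2 x) - (1 - x) * log2 (1 - x).

Definition bconv (a b : R) : R := a * (1 - b) + b * (1 - a).

Definition prob_of {O : finType} (mu : O -> R) (E : pred O) : R :=
  \sum_(w | E w) mu w.

Definition mutual_info {O A B : finType} (mu : O -> R) (U : O -> A) (V : O -> B)
    : R :=
  \sum_(a : A) \sum_(b : B)
    let pab := prob_of mu (fun w => (U w == a) && (V w == b)) in
    let pa := prob_of mu (fun w => U w == a) in
    let pb := prob_of mu (fun w => V w == b) in
    pab * log2 (pab / (pa * pb)).

End Information.

Section DecoderSideInformation.
Context {R : realType}.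

Definition iid_pmf {A : finType} (mu : A -> R) (n : nat) (w : {ffun 'I_n -> A})
    : R :=
  \prod_(i < n) mu (w i).

Definition block_X1 {n : nat} (w : {ffun 'I_n -> bool * bool * bool})
  : {ffun 'I_n -> bool} := [ffun i => (w i).1.1].
Definition block_X2 {n : nat} (w : {ffun 'I_n -> bool * bool * bool})
  : {ffun 'I_n -> bool} := [ffun i => (w i).1.2].
Definition block_Y {n : nat} (w : {ffun 'I_n -> bool * bool * bool})
  : {ffun 'I_n -> bool} := [ffun i => (w i).2].

Definition achievable (law : bool * bool * bool -> R) (rate mu : R) : Prop :=
  [/\ 0 <= rate, 0 <= mu &
    forall eps : R, 0 < eps ->
      exists n0 : nat, forall n : nat, (n0 < n)%N ->
        exists (I : finType) (phi : {ffun 'I_n -> bool} -> I),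
          n%:R^-1 * log2 #|I|%:R <= rate + eps /\
          mu - eps <=
            n%:R^-1 * mutual_info (@iid_pmf _ law n) block_Y
                        (fun w => (phi (block_X1 w), block_X2 w))].

(* This set contains 0 for [rate >= 0] and is bounded above by 1, so the real
   [sup] is a genuine supremum. *)
Definition relevance_rate (law : bool * bool * bool -> R) (rate : R) : R :=
  sup [set mu | achievable law rate mu].

End DecoderSideInformation.

Section RateFunctions.
Context {R : realType}.
Context (p q : R).

Definition g_rate (r : R) : R := h2 (bconv r q) - h2 r.

Definition f_rel (r : R) : R :=
  h2 (bconv r q)
  - (1 - bconv p q) * h2 (bconv r (p * q / (1 - bconv p q)))
  - bconv p q * h2 (bconv r (p * (1 - q) / bconv p q)).

(* The default value 0 is used only outside the image of [0, 1/2] under [g_rate]. *)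
Definition ginv : R -> R := 'pinv_(fun=> 0) `[0, 2^-1] g_rate.

(* The line from the origin touches the graph of f_rel o ginv at Rc. Such an Rc
   need not exist: for p = q = 2/5, f_rel o ginv is strictly concave. *)
Definition critical_rate (Rc : R) : Prop :=
  0 < Rc < h2 q /\
  derive1 f_rel (ginv Rc) / derive1 g_rate (ginv Rc) = f_rel (ginv Rc) / Rc.

End RateFunctions.

(* Main.v *)
Require Import Defs.
From mathcomp Require Import all_boot all_order all_algebra.
From mathcomp Require Import all_classical all_reals all_analysis.
From mathcomp Require Import ring lra.
Import Order.TTheory GRing.Theory Num.Theory.
Import numFieldNormedType.Exports.
Local Open Scope classical_set_scope.
Local Open Scope ring_scope.
Set Implicit Arguments.
Unset Strict Implicit.
Unset Printing Implicit Defensive.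

                                            

(** Put Z = X1 xor X2 and W = X1 xor Y; these are independent, Bern(q) and Bern(p). Let S be such
    that (S, X1) is independent of (Z, W), and let r be the conditional probability of X1 = 1 given
    S. Then H(X1|S,X2) = h2(q) - E g(r) and H(Y|S,X2) = h2([bconv p q]) - E f(r), by [cent_X1_X2]
    and [cent_Y_X2]. Describing S to a decoder that knows X2 therefore costs E g(r) bits and yields
    relevance 1 - h2([bconv p q]) + E f(r), so the answer is governed by the upper concave envelope
    of the curve r -> (g(r), f(r)).

    Converse ([converse]). With S_i made of the earlier letters of X1, the message, and X2 off
    position i, the chain rule bounds the sum of the E g(r_i) by the logarithm of the number of
    messages, and the mutual information by n(1 - h2([bconv p q])) plus the sum of the E f(r_i).
    Every affine majorant f <= c g + M on [0, 1] then bounds the relevance at rate R by 1 -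
    h2([bconv p q]) + M + c R.

    Achievability ([achievability]). A fraction lam of the letters is quantized to a codeword at
    normalized distance about r ([quantizer]), and the codeword is hashed into a random bin
    ([random_binning]). The side information differs from the codeword in a fraction about
    [bconv r q] of these letters and resolves the bin, so the cost per coded letter is (1 - h2(r)) -
    (1 - h2([bconv r q])) = g(r). Convexity of f guarantees relevance f(r) per coded letter.

    Matching the two ([relevance_rate_critical]). A tangent line must be shown to be a global
    majorant. The numerator of f'' - c g'' is a polynomial of degree at most two in (1 - 2r)^2,
    negative at 1, which excludes the sign pattern +, -, + as r decreases from 1/2
    ([ddf_ddg_pattern]). Mean value arguments turn this into [tangent_max]: a tangent of positive
    slope with nonnegative intercept majorizes the curve. At [Rc] the tangent passes through the
    origin and gives the straight piece; beyond [Rc] tangents are less steep and keep a nonnegative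
    intercept ([tangent_slope], [tangent_intercept]). From h2(q) on, the constant majorant f(0) is
    approached by letting r tend to 0. *)

Section Logarithm.
Context {R : realType}.
Implicit Types x y : R.

(** * Binary logarithm and binary entropy *)

Lemma ln2_gt0 : 0 < ln 2 :> R.
Proof. by apply: ln_gt0; rewrite ltr1n. Qed.

Lemma log21 : log2 1 = 0 :> R.
Proof. by rewrite /log2 ln1 mul0r. Qed.

Lemma log20 : log2 0 = 0 :> R.
Proof. by rewrite /log2 ln0 ?mul0r. Qed.

Lemma log22 : log2 2 = 1 :> R.
Proof. by rewrite /log2 divff// gt_eqF// ln2_gt0. Qed.

Lemma log2M x y : 0 < x -> 0 < y -> log2 (x * y) = log2 x + log2 y.
Proof. by move=> x0 y0; rewrite /log2 lnM ?posrE// mulrDl. Qed.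

Lemma log2V x : 0 < x -> log2 x^-1 = - log2 x.
Proof. by move=> x0; rewrite /log2 lnV ?posrE// mulNr. Qed.

Lemma log2_div x y : 0 < x -> 0 < y -> log2 (x / y) = log2 x - log2 y.
Proof. by move=> x0 y0; rewrite log2M ?invr_gt0// log2V. Qed.

Lemma log2X x n : 0 < x -> log2 (x ^+ n) = n%:R * log2 x.
Proof. by move=> x0; rewrite /log2 lnXn// -[ln x *+ n]mulr_natl mulrA. Qed.

Lemma log2_half : log2 2^-1 = -1 :> R.
Proof. by rewrite log2V// log22. Qed.

Lemma log2_prod (I : finType) (F : I -> R) (A : pred I) :
  (forall i, A i -> 0 < F i) -> log2 (\prod_(i | A i) F i) = \sum_(i | A i) log2 (F i).
Proof.
move=> F0; pose K (a b : R) := 0 < a /\ log2 a = b.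
suff [] : K (\prod_(i | A i) F i) (\sum_(i | A i) log2 (F i)) by [].
apply: (big_ind2 K); first by split=> //; rewrite log21.
- by move=> a b a' b' [a0 <-] [b0 <-]; split; [exact: mulr_gt0 | rewrite log2M].
- by move=> i /F0.
Qed.

Lemma ler_log2 x y : 0 < x -> x <= y -> log2 x <= log2 y.
Proof.
move=> x0 xy; rewrite /log2 ler_pM2r ?invr_gt0 ?ln2_gt0//.
by rewrite ler_ln ?posrE// (lt_le_trans x0).
Qed.

Lemma log2_ge0 x : 1 <= x -> 0 <= log2 x.
Proof. by move=> x1; rewrite -log21 ler_log2. Qed.

Lemma log2_le0 x : x <= 1 -> log2 x <= 0.
Proof.
move=> x1; have [x0|x0] := ltP 0 x; first by rewrite -log21 ler_log2.
by rewrite /log2 ln0// mul0r.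
Qed.

Lemma ln_le_sub1 x : 0 < x -> ln x <= x - 1.
Proof.
move=> x0; have : -1 < x - 1 by rewrite ltrBrDl subrr.
by move=> /le_ln1Dx; rewrite addrC subrK.
Qed.

Lemma log2_le_sub1 x : 0 < x -> log2 x <= (x - 1) / ln 2.
Proof. by move=> x0; rewrite /log2 ler_pM2r ?invr_gt0 ?ln2_gt0// ln_le_sub1. Qed.

End Logarithm.

Section BinaryEntropy.
Context {R : realType}.
Implicit Types x r : R.

Lemma h2C x : h2 (1 - x) = h2 x.
Proof. by rewrite /h2 opprB addrCA subrr addr0; ring. Qed.

Lemma h2_half : h2 2^-1 = 1 :> R.
Proof.
have -> : h2 (2^-1 : R) = - (2^-1 * log2 2^-1) - (1 - 2^-1) * log2 (1 - 2^-1) by [].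
have -> : 1 - 2^-1 = 2^-1 :> R by lra.
by rewrite log2_half; lra.
Qed.

Lemma h20 : h2 0 = 0 :> R.
Proof. by rewrite /h2 subr0 log21 log20; lra. Qed.

Definition dh2 x : R := log2 (1 - x) - log2 x.
Definition ddh2 x : R := - (ln 2 * (x * (1 - x)))^-1.

Lemma is_derive_log2 x : 0 < x -> is_derive x 1 (@log2 R) ((x * ln 2)^-1).
Proof.
move=> x0; rewrite invfM mulrC.
have -> : @log2 R = (ln 2)^-1 *: @ln R by apply/funext => y; rewrite /log2/= mulrC.
have := is_derive1_ln x0 => H.
exact: is_deriveZ.
Qed.

Lemma is_derive_1B x : is_derive x 1 (fun y : R => 1 - y) (-1).
Proof.
have := is_deriveB (is_derive_cst (1 : R) x 1) (is_derive_id x 1).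
by rewrite sub0r.
Qed.

Lemma is_derive_dh2 x : 0 < x < 1 -> is_derive x 1 dh2 (ddh2 x).
Proof.
move=> /andP[x0 x1].
have H1 := @is_derive_log2 (1 - x).
rewrite subr_gt0 in H1; have {}H1 := H1 x1.
have H2 := is_derive_log2 x0.
have H3 := is_derive_1B x.
have H4 := is_derive1_comp (g := fun y : R => 1 - y) H1 H3.
have H5 := is_deriveB H4 H2.
rewrite /dh2/ddh2; apply: is_derive_eq H5 _.
have l := @ln2_gt0 R; field.
by rewrite !gt_eqF//= subr_gt0.
Qed.

Lemma is_derive_h2 x : 0 < x < 1 -> is_derive x 1 (@h2 R) (dh2 x).
Proof.
move=> /andP[x0 x1].
have x1' : 0 < 1 - x by rewrite subr_gt0.
have H1 := is_derive_log2 x1'.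
have H2 := is_derive_log2 x0.
have H3 := is_derive_1B x.
have H4 := is_derive1_comp (g := fun y : R => 1 - y) H1 H3.
have H5 := is_deriveB (is_deriveN (is_deriveM (is_derive_id x 1) H2)) (is_deriveM H3 H4).
have -> : @h2 R = - (id * @log2 R) - (fun y : R => 1 - y) * (@log2 R \o (fun y : R => 1 - y)).
  by apply/funext => y.
apply: is_derive_eq H5 _.
rewrite /dh2 /=.
have l := @ln2_gt0 R.
rewrite /GRing.scale/= ; field.
by rewrite !gt_eqF//= subr_gt0.
Qed.

Lemma is_derive_bconv a r : is_derive r 1 (fun r => bconv r a) (1 - 2 * a).
Proof.
have -> : (fun r : R => bconv r a) = cst a + (1 - 2 * a) *: (id : R -> R).
  apply/funext => y; rewrite /bconv/=.
  change (y * (1 - a) + a * (1 - y) = a + (1 - 2 * a) * y); ring.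
have H : is_derive r 1 ((1 - 2 * a) *: (id : R -> R)) ((1 - 2 * a) *: 1) by exact: is_deriveZ.
have := is_deriveD (is_derive_cst a r 1) H.
by rewrite add0r /GRing.scale/= mulr1.
Qed.

Lemma bconv_itv a r : 0 < a < 1 -> 0 <= r <= 1 -> 0 < bconv r a < 1.
Proof.
move=> /andP[a0 a1] /andP[r0 r1]; rewrite /bconv; apply/andP; split; nra.
Qed.

Lemma bconv_1B a r : bconv (1 - r) a = 1 - bconv r a.
Proof. by rewrite /bconv; ring. Qed.

Lemma bconv_half a : bconv 2^-1 a = 2^-1 :> R.
Proof. by rewrite /bconv; field. Qed.

Lemma is_derive_h2_bconv a r : 0 < a < 1 -> 0 <= r <= 1 ->
  is_derive r 1 (fun r => h2 (bconv r a)) ((1 - 2 * a) * dh2 (bconv r a)).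
Proof.
move=> ha hr.
have := is_derive1_comp (g := fun r => bconv r a)
  (is_derive_h2 (bconv_itv ha hr)) (is_derive_bconv a r).
by rewrite mulrC.
Qed.

Lemma is_derive_dh2_bconv a r : 0 < a < 1 -> 0 <= r <= 1 ->
  is_derive r 1 (fun r => dh2 (bconv r a)) ((1 - 2 * a) * ddh2 (bconv r a)).
Proof.
move=> ha hr.
have := is_derive1_comp (g := fun r => bconv r a)
  (is_derive_dh2 (bconv_itv ha hr)) (is_derive_bconv a r).
by rewrite mulrC.
Qed.

(** With t = [bconv r a], the product t(1 - t) is (1 - (1 - 2a)^2 (1 - 2r)^2)/4. Every second
    derivative below thus becomes a rational function of the single variable (1 - 2r)^2, and sign
    questions become polynomial. *)
Lemma ddh2_bconv a r : ddh2 (bconv r a) = - (4 / ln 2) / (1 - (1 - 2 * a) ^+ 2 * (1 - 2 * r) ^+ 2).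
Proof.
rewrite /ddh2.
have -> : bconv r a * (1 - bconv r a) = (1 - (1 - 2 * a) ^+ 2 * (1 - 2 * r) ^+ 2) / 4.
  by rewrite /bconv; field.
by rewrite !invfM invrK; ring.
Qed.

Lemma dh2_half : dh2 (2^-1 : R) = 0.
Proof.
have e : 1 - 2^-1 = 2^-1 :> R by lra.
by rewrite /dh2 e subrr.
Qed.

Lemma h2_le1 x : 0 <= x <= 1 -> h2 x <= 1.
Proof.
move=> /andP[x0 x1].
have L := @ln2_gt0 R.
(* The right side is the tangent at y = 1/2 of the concave function -y log2 y; its values at x and 1
   - x add up to 1. *)
have key (y : R) : 0 <= y -> - (y * log2 y) <= y + (2^-1 - y) / ln 2.
  move=> y0; have [->|yn] := eqVneq y 0.
    by rewrite log20 mul0r oppr0 add0r addr0 divr_ge0// ltW.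
  have {y0 yn}y0 : 0 < y by rewrite lt_neqAle eq_sym yn.
  have := @log2_le_sub1 R (2^-1 / y) (divr_gt0 _ y0).
  rewrite invr_gt0 ltr0n => /(_ isT).
  rewrite log2_div ?invr_gt0// log2_half => H.
  have {}H : - log2 y <= 1 + (2^-1 / y - 1) / ln 2 by lra.
  rewrite -mulrN; apply: (le_trans (ler_wpM2l (ltW y0) H)).
  rewrite le_eqVlt; apply/orP; left; apply/eqP; field.
  by rewrite !gt_eqF.
have := key x x0; have := key (1 - x); rewrite subr_ge0 => /(_ x1).
rewrite /h2 => h1 h3.
have e : (2^-1 - x) / ln 2 + (2^-1 - (1 - x)) / ln 2 = 0.
  rewrite -mulrDl; have -> : (2^-1 - x) + (2^-1 - (1 - x)) = 0 by lra.
  by rewrite mul0r.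
lra.
Qed.

End BinaryEntropy.

                                    

(** * Derivatives of the rate functions and the sign of their second derivatives *)

Section RateFunctionDerivatives.
Context {R : realType}.
Variables p q : R.
Implicit Types r x s c : R.
Hypotheses (p_range : 0 < p < 2^-1) (q_range : 0 < q < 2^-1).

(** [w2] is the probability that X2 and Y differ, [ca] the probability that X1 and X2 differ given
    X2 = Y, and [cb] the probability that X1 = X2 given that X2 and Y differ. *)
Let w1 := 1 - bconv p q.
Let w2 := bconv p q.
Let ca := p * q / (1 - bconv p q).
Let cb := p * (1 - q) / bconv p q.

Lemma bconv_pq_range : 0 < bconv p q < 2^-1.
Proof.
move: p_range q_range => /andP[p0 p1] /andP[q0 q1].
by rewrite /bconv; apply/andP; split; nra.
Qed.

Let ca_range : 0 < ca < 1.
Proof.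
have /andP[w0 w1'] := bconv_pq_range.
move: p_range q_range => /andP[p0 p1] /andP[q0 q1].
have w10 : 0 < 1 - bconv p q by lra.
rewrite /ca divr_gt0 ?mulr_gt0//= ltr_pdivrMr// mul1r /bconv; nra.
Qed.

Let cb_range : 0 < cb < 1.
Proof.
have /andP[w0 w1'] := bconv_pq_range.
move: p_range q_range => /andP[p0 p1] /andP[q0 q1].
rewrite /cb divr_gt0 ?mulr_gt0//= ?ltr_pdivrMr// ?mul1r /bconv; nra.
Qed.

Let q01 : 0 < q < 1.
Proof. by move: q_range => /andP[q0 q1]; apply/andP; split=> //; lra. Qed.

Definition dg_rate (r : R) : R := (1 - 2 * q) * dh2 (bconv r q) - dh2 r.
Definition ddg_rate (r : R) : R :=
  (1 - 2 * q) * ((1 - 2 * q) * ddh2 (bconv r q)) - ddh2 r.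
Definition df_rel (r : R) : R :=
  (1 - 2 * q) * dh2 (bconv r q) - w1 * ((1 - 2 * ca) * dh2 (bconv r ca))
  - w2 * ((1 - 2 * cb) * dh2 (bconv r cb)).
Definition ddf_rel (r : R) : R :=
  (1 - 2 * q) * ((1 - 2 * q) * ddh2 (bconv r q))
  - w1 * ((1 - 2 * ca) * ((1 - 2 * ca) * ddh2 (bconv r ca)))
  - w2 * ((1 - 2 * cb) * ((1 - 2 * cb) * ddh2 (bconv r cb))).

Let is_deriveZ' (f : R -> R) (k x df : R) :
  is_derive x 1 f df -> is_derive x 1 (fun y => k * f y) (k * df).
Proof. by move=> h; exact: (is_deriveZ k h). Qed.

Lemma is_derive_g_rate r : 0 < r < 1 -> is_derive r 1 (g_rate q) (dg_rate r).
Proof.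
move=> r01; have r01' : 0 <= r <= 1 by move: r01 => /andP[/ltW -> /ltW ->].
exact: (is_deriveB (is_derive_h2_bconv q01 r01') (is_derive_h2 r01)).
Qed.

Lemma is_derive_dg_rate r : 0 < r < 1 -> is_derive r 1 dg_rate (ddg_rate r).
Proof.
move=> r01; have r01' : 0 <= r <= 1 by move: r01 => /andP[/ltW -> /ltW ->].
exact: (is_deriveB (is_deriveZ' _ (is_derive_dh2_bconv q01 r01')) (is_derive_dh2 r01)).
Qed.

Lemma is_derive_f_rel r : 0 <= r <= 1 -> is_derive r 1 (f_rel p q) (df_rel r).
Proof.
move=> r01.
exact: (is_deriveB (is_deriveB (is_derive_h2_bconv q01 r01)
  (is_deriveZ' _ (is_derive_h2_bconv ca_range r01)))
  (is_deriveZ' _ (is_derive_h2_bconv cb_range r01))).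
Qed.

Lemma is_derive_df_rel r : 0 <= r <= 1 -> is_derive r 1 df_rel (ddf_rel r).
Proof.
move=> r01.
exact: (is_deriveB (is_deriveB (is_deriveZ' _ (is_derive_dh2_bconv q01 r01))
  (is_deriveZ' _ (is_deriveZ' _ (is_derive_dh2_bconv ca_range r01))))
  (is_deriveZ' _ (is_deriveZ' _ (is_derive_dh2_bconv cb_range r01)))).
Qed.

Lemma g_rateC r : g_rate q (1 - r) = g_rate q r.
Proof. by rewrite /g_rate bconv_1B !h2C. Qed.

Lemma f_relC r : f_rel p q (1 - r) = f_rel p q r.
Proof. by rewrite /f_rel !bconv_1B !h2C. Qed.

Lemma g_rate_half : g_rate q 2^-1 = 0.
Proof. by rewrite /g_rate bconv_half subrr. Qed.

Lemma f_rel_half : f_rel p q 2^-1 = 0.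
Proof. by rewrite /f_rel !bconv_half h2_half; ring. Qed.

Lemma dg_rate_half : dg_rate 2^-1 = 0.
Proof. by rewrite /dg_rate bconv_half dh2_half; ring. Qed.

Lemma df_rel_half : df_rel 2^-1 = 0.
Proof. by rewrite /df_rel !bconv_half dh2_half; ring. Qed.

Lemma g_rate0 : g_rate q 0 = h2 q.
Proof.
have -> : g_rate q 0 = h2 (bconv 0 q) - h2 (0 : R) by [].
by rewrite h20 /bconv mul0r add0r !subr0 mulr1.
Qed.

Let ddh2E r : ddh2 r = - (4 / ln 2) / (1 - (1 - 2 * r) ^+ 2).
Proof.
have := ddh2_bconv 0 r; rewrite mulr0 subr0 expr1n mul1r => <-.
by rewrite /bconv subr0 mulr1 mul0r addr0.
Qed.

Let sqr_lt1 s : 0 < s < 1 -> 0 <= (1 - 2 * s) ^+ 2 < 1.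
Proof. by move=> /andP[s0 s1]; rewrite sqr_ge0/=; nra. Qed.

Let den_gt0 (A x : R) : 0 <= A < 1 -> 0 <= x <= 1 -> 0 < 1 - A * x.
Proof. by move=> /andP[A0 A1] /andP[x0 x1]; nra. Qed.

Let sqr_le1 r : 0 <= r <= 1 -> 0 <= (1 - 2 * r) ^+ 2 <= 1.
Proof. by move=> /andP[s0 s1]; rewrite sqr_ge0/=; nra. Qed.

Lemma ddg_rate_gt0 r : 0 < r < 1 -> 0 < ddg_rate r.
Proof.
have L := @ln2_gt0 R.
move=> r01; rewrite /ddg_rate mulrA -expr2 ddh2_bconv ddh2E.
have /andP[C0 C1] := sqr_lt1 q01; have /andP[x0 x1] := sqr_lt1 r01.
set C := (1 - 2 * q) ^+ 2 in C0 C1 *; set x := (1 - 2 * r) ^+ 2 in x0 x1 *.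
have h1 : 0 < 1 - C * x by apply: den_gt0; rewrite ?C0// x0 ltW.
have h2 : 0 < 1 - x by rewrite subr_gt0.
have -> : C * (- (4 / ln 2) / (1 - C * x)) - - (4 / ln 2) / (1 - x)
   = 4 / ln 2 * (1 - C) / ((1 - C * x) * (1 - x)).
  by field; rewrite !gt_eqF.
have ? : 0 < 1 - C by rewrite subr_gt0.
by rewrite divr_gt0 ?mulr_gt0 ?invr_gt0.
Qed.

(** Over a common denominator the numerator is affine in x = (1 - 2r)^2, since [w1 + w2 = 1] cancels
    the x^2 term. Its values at x = 0 and x = 1 are the quantities in [E0] and [E1], and both have
    manifestly positive closed forms. *)
Lemma ddf_rel_gt0 r : 0 <= r <= 1 -> 0 < ddf_rel r.
Proof.
move=> r01; rewrite /ddf_rel !(mulrA (1 - 2 * _)) -!expr2 !ddh2_bconv.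
have /andP[A0 A1] := sqr_lt1 ca_range.
have /andP[B0 B1] := sqr_lt1 cb_range.
have /andP[C0 C1] := sqr_lt1 q01; have /andP[x0 x1] := sqr_le1 r01.
have [/andP[w20 w21] L] := (bconv_pq_range, @ln2_gt0 R).
have w10 : 0 < w1 by rewrite /w1; lra.
have w20' : w2 != 0 by rewrite gt_eqF.
have w10' : w1 != 0 by rewrite gt_eqF.
have pE : ca = p * q / w1 by [].
have pE2 : cb = p * (1 - q) / w2 by [].
have w1E : w1 = 1 - p - q + 2 * p * q by rewrite /w1 /bconv; ring.
have w2E : w2 = p + q - 2 * p * q by rewrite /w2 /bconv; ring.
move: p_range q_range => /andP[p0 p1] /andP[q0 q1].
set A := (1 - 2 * ca) ^+ 2 in A0 A1 *.
set B := (1 - 2 * cb) ^+ 2 in B0 B1 *.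
set C := (1 - 2 * q) ^+ 2 in C0 C1 *; set x := (1 - 2 * r) ^+ 2 in x0 x1 *.
have h1 : 0 < 1 - A * x by apply: den_gt0; rewrite ?A0 ?x0.
have h2 : 0 < 1 - B * x by apply: den_gt0; rewrite ?B0 ?x0.
have h3 : 0 < 1 - C * x by apply: den_gt0; rewrite ?C0 ?x0.
have E0 : 0 < w1 * A + w2 * B - C.
  have -> : w1 * A + w2 * B - C = 4 * (1 - 2 * p) ^+ 2 * q ^+ 2 * (1 - q) ^+ 2 / (w1 * w2).
    rewrite /A /B /C pE pE2 w1E w2E; field.
    by rewrite -w1E -w2E w10' w20'.
  rewrite !(divr_gt0, mulr_gt0, exprn_gt0)//; lra.
have E1 : 0 < w1 * A * (1 - B) * (1 - C) + w2 * B * (1 - A) * (1 - C)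
              - C * (1 - A) * (1 - B).
  have -> : w1 * A * (1 - B) * (1 - C) + w2 * B * (1 - A) * (1 - C)
              - C * (1 - A) * (1 - B)
     = (1 - A) * (1 - B) * ((1 - 2 * p) ^+ 2 * (1 + 3 * C)) / (4 * p * (1 - p)).
    rewrite /A /B /C pE pE2 w1E w2E; field.
    by rewrite -w1E -w2E w10' w20' !gt_eqF//; lra.
  by rewrite divr_gt0// !mulr_gt0 ?exprn_gt0//; lra.
have -> : C * (- (4 / ln 2) / (1 - C * x)) - w1 * (A * (- (4 / ln 2) / (1 - A * x))) -
    w2 * (B * (- (4 / ln 2) / (1 - B * x))) =
  4 / ln 2 * ((w1 * A + w2 * B - C) * (1 - x)
              + x * (w1 * A * (1 - B) * (1 - C) + w2 * B * (1 - A) * (1 - C)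
              - C * (1 - A) * (1 - B))) / ((1 - A * x) * (1 - B * x) * (1 - C * x)).
  have -> : w2 = 1 - w1 by rewrite w1E w2E; ring.
  by field; rewrite !gt_eqF.
rewrite divr_gt0 ?mulr_gt0 ?invr_gt0//.
have [xz|xn] := eqVneq x 0; first by rewrite xz; lra.
have {}x0 : 0 < x by rewrite lt_neqAle eq_sym xn.
have := mulr_gt0 x0 E1; have : 0 <= (w1 * A + w2 * B - C) * (1 - x).
  by rewrite mulr_ge0 ?(ltW E0)// subr_ge0.
lra.
Qed.

                                                                         
                                                                           
                                               
(** Up to positive factors f'' - c g'' is [E x] at x = (1 - 2r)^2. The cubic term of [E] cancels
    because [w1 + w2 = 1], and [E 1 < 0]. As r decreases, x increases towards 1, so the three signs
    together with [E 1 < 0] would be too many turns for a polynomial of degree at most two. *)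
Lemma ddf_ddg_pattern c r1 r2 r3 : 0 < c -> 0 < r3 -> r3 < r2 -> r2 < r1 -> r1 < 2^-1 ->
  0 <= ddf_rel r1 - c * ddg_rate r1 -> ddf_rel r2 - c * ddg_rate r2 <= 0 ->
  0 < ddf_rel r3 - c * ddg_rate r3 -> False.
Proof.
move=> c0 r30 r32 r21 r12.
have /andP[A0 A1] := sqr_lt1 ca_range.
have /andP[B0 B1] := sqr_lt1 cb_range.
have /andP[C0 C1] := sqr_lt1 q01.
have [/andP[w20 w21] L] := (bconv_pq_range, @ln2_gt0 R).
have w12 : w2 = 1 - w1 by rewrite /w1 /w2; ring.
set A := (1 - 2 * ca) ^+ 2 in A0 A1 *.
set B := (1 - 2 * cb) ^+ 2 in B0 B1 *.
set C := (1 - 2 * q) ^+ 2 in C0 C1 *.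
pose X r := (1 - 2 * r) ^+ 2 : R.
pose D x := (1 - A * x) * (1 - B * x) * (1 - C * x) * (1 - x).
pose E x := w1 * A * (1 - B * x) * (1 - C * x) * (1 - x)
  + w2 * B * (1 - A * x) * (1 - C * x) * (1 - x)
  - (1 - c) * C * (1 - A * x) * (1 - B * x) * (1 - x)
  - c * (1 - A * x) * (1 - B * x) * (1 - C * x).
pose e1 := - (w1 * A * (B + C + 1) + w2 * B * (A + C + 1) - (1 - c) * C * (A + B + 1)
   - c * (A + B + C)).
pose e0 := w1 * A + w2 * B - (1 - c) * C - c.
pose e2 := w1 * A * (B * C + B + C) + w2 * B * (A * C + A + C)
  - (1 - c) * C * (A * B + A + B) - c * (A * B + A * C + B * C).
have EE x : E x = e0 + e1 * x + e2 * x ^+ 2.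
  by rewrite /E /e0 /e1 /e2 w12; ring.
have E1 : E 1 < 0.
  have -> : E 1 = - (c * (1 - A) * (1 - B) * (1 - C)) by rewrite /E; ring.
  by rewrite oppr_lt0 !mulr_gt0// subr_gt0.
have key r : 0 < r -> r < 2^-1 ->
    0 < D (X r) /\ ddf_rel r - c * ddg_rate r = 4 / ln 2 * E (X r) / D (X r).
  move=> r_gt0 r_lt.
  have r01 : 0 < r < 1 by rewrite r_gt0; lra.
  have /andP[x0 x1] := sqr_lt1 r01; rewrite -/(X r) in x0 x1.
  have h1 : 0 < 1 - A * X r by apply: den_gt0; rewrite ?A0// x0 ltW.
  have h2 : 0 < 1 - B * X r by apply: den_gt0; rewrite ?B0// x0 ltW.
  have h3 : 0 < 1 - C * X r by apply: den_gt0; rewrite ?C0// x0 ltW.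
  have h4 : 0 < 1 - X r by rewrite subr_gt0.
  split; first by rewrite /D !mulr_gt0.
  rewrite /ddf_rel /ddg_rate !(mulrA (1 - 2 * _)) -!expr2 !ddh2_bconv ddh2E.
  rewrite -/A -/B -/C -/(X r) /E /D.
  by field; rewrite !gt_eqF.
have r10 : 0 < r1 by lra.
have r20 : 0 < r2 by lra.
have [D1 ->] := key r1 r10 r12.
have [D2 ->] := key r2 r20 (ltac:(lra)).
have [D3 ->] := key r3 r30 (ltac:(lra)).
have L' : 0 < 4 / ln 2 :> R by rewrite divr_gt0.
rewrite pmulr_lge0 ?invr_gt0// pmulr_lle0 ?invr_gt0// pmulr_lgt0 ?invr_gt0//.
rewrite pmulr_rge0// pmulr_rle0// pmulr_rgt0//.
have x12 : X r1 < X r2 by rewrite /X; nra.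
have x23 : X r2 < X r3 by rewrite /X; nra.
have x31 : X r3 < 1 by rewrite /X; nra.
move: E1; rewrite !EE.
set x1 := X r1 in x12 *; set x2 := X r2 in x12 x23 *; set x3 := X r3 in x23 x31 *.
rewrite expr1n !mulr1 => h h1 h2 h3.
(* Chord slopes of [E] over [x2, x3], [x1, x2] and [x3, 1]. The first exceeding the second forces e2
   > 0; the third lying below the first forces e2 < 0. *)
have s32 : 0 < e1 + e2 * (x3 + x2).
  have : 0 < (e1 + e2 * (x3 + x2)) * (x3 - x2).
    have -> : (e1 + e2 * (x3 + x2)) * (x3 - x2) =
        (e0 + e1 * x3 + e2 * x3 ^+ 2) - (e0 + e1 * x2 + e2 * x2 ^+ 2) by ring.
    by rewrite subr_gt0 (le_lt_trans h2).
  by rewrite pmulr_lgt0// subr_gt0.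
have s21 : e1 + e2 * (x2 + x1) <= 0.
  have : (e1 + e2 * (x2 + x1)) * (x2 - x1) <= 0.
    have -> : (e1 + e2 * (x2 + x1)) * (x2 - x1) =
        (e0 + e1 * x2 + e2 * x2 ^+ 2) - (e0 + e1 * x1 + e2 * x1 ^+ 2) by ring.
    by rewrite subr_le0 (le_trans h2).
  by rewrite pmulr_lle0// subr_gt0.
have s13 : e1 + e2 * (1 + x3) < 0.
  have : (e1 + e2 * (1 + x3)) * (1 - x3) < 0.
    have -> : (e1 + e2 * (1 + x3)) * (1 - x3) =
        (e0 + e1 + e2) - (e0 + e1 * x3 + e2 * x3 ^+ 2) by ring.
    by rewrite subr_lt0 (lt_trans h).
  by rewrite pmulr_llt0// subr_gt0.
have t1 : 0 < e2 * (x3 - x1) by lra.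
have t2 : e2 * (1 - x2) < 0 by lra.
have e20 : 0 < e2 by rewrite -(pmulr_lgt0 _ (_ : 0 < x3 - x1))//; lra.
have : 0 < e2 * (1 - x2) by rewrite mulr_gt0//; lra.
lra.
Qed.

End RateFunctionDerivatives.

(** * Behaviour at zero, mean value arguments, and tangents to the curve of [f_rel] against
    [g_rate] *)

Section EntropyAtZero.
Context {R : realType}.
Implicit Types x : R.

Lemma h2_ge0 x : 0 <= x <= 1 -> 0 <= h2 x.
Proof.
move=> /andP[x0 x1]; rewrite /h2.
have : x * log2 x <= 0 by rewrite mulr_ge0_le0// log2_le0.
have : (1 - x) * log2 (1 - x) <= 0 by rewrite mulr_ge0_le0 ?subr_ge0// log2_le0// gerBl.
lra.
Qed.

(** Supplies continuity of [h2] at 0, where its slope is infinite. With x = s^2 the inequality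
    ln(1/s) <= 1/s - 1 bounds x ln(1/s) by s. *)
Lemma h2_le_sqrt x : 0 < x <= 2^-1 -> h2 x <= 3 / ln 2 * Num.sqrt x.
Proof.
move=> /andP[x0 x1]; have L := @ln2_gt0 R.
set s := Num.sqrt x.
have s0 : 0 < s by rewrite sqrtr_gt0.
have xE : x = s ^+ 2 by rewrite sqr_sqrtr// ltW.
have s1 : s < 1 by nra.
have A : - (x * log2 x) <= 2 * s / ln 2.
  have : ln s^-1 <= s^-1 - 1 by rewrite ln_le_sub1// invr_gt0.
  rewrite lnV ?posrE// => H.
  have : log2 x = 2 * ln s / ln 2 by rewrite /log2 xE lnXn// -[ln s *+ 2]mulr_natl.
  move=> ->.
  have -> : - (x * (2 * ln s / ln 2)) = 2 * (x * - ln s) / ln 2 by ring.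
  rewrite ler_pM2r ?invr_gt0// ler_pM2l//.
  apply: (@le_trans _ _ (x * (s^-1 - 1))); first by rewrite ler_pM2l.
  have -> : x * (s^-1 - 1) = s - x by rewrite xE; field; rewrite gt_eqF.
  by rewrite gerBl ltW.
have B : - ((1 - x) * log2 (1 - x)) <= s / ln 2.
  have y0 : 0 < 1 - x by lra.
  have : ln (1 - x)^-1 <= (1 - x)^-1 - 1 by rewrite ln_le_sub1// invr_gt0.
  rewrite lnV ?posrE// => H.
  have -> : - ((1 - x) * log2 (1 - x)) = (1 - x) * (- ln (1 - x)) / ln 2 by rewrite /log2; ring.
  rewrite ler_pM2r ?invr_gt0//.
  apply: (@le_trans _ _ ((1 - x) * ((1 - x)^-1 - 1))); first by rewrite ler_pM2l.
  have -> : (1 - x) * ((1 - x)^-1 - 1) = x by field; rewrite gt_eqF.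
  by rewrite xE expr2; nra.
rewrite /h2; have -> : 3 / ln 2 * s = 2 * s / ln 2 + s / ln 2 by field; rewrite gt_eqF.
lra.
Qed.

Lemma h2_cvg0 : h2 x @[x --> 0^'+] --> (0 : R).
Proof.
have L := @ln2_gt0 R.
apply/cvgrPdist_lt => e e0.
have d0 : 0 < (e * ln 2 / 3) ^+ 2 by rewrite exprn_gt0// divr_gt0// mulr_gt0.
near=> x.
have x0 : 0 < x by near: x; exact: nbhs_right_gt.
have x1 : x <= 2^-1 by near: x; apply: nbhs_right_le.
have xd : x < (e * ln 2 / 3) ^+ 2 by near: x; exact: nbhs_right_lt.
have x01 : 0 <= x <= 1 by lra.
rewrite sub0r normrN ger0_norm ?h2_ge0//.
apply: (le_lt_trans (h2_le_sqrt _)); first by rewrite x0.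
have : Num.sqrt x < e * ln 2 / 3.
  rewrite -(@ger0_norm _ (e * ln 2 / 3)); last by rewrite divr_ge0 ?mulr_ge0// ltW.
  by rewrite -sqrtr_sqr ltr_sqrt.
rewrite -(ltr_pM2l (_ : 0 < 3 / ln 2)); last by rewrite divr_gt0.
have -> // : 3 / ln 2 * (e * ln 2 / 3) = e by field; rewrite gt_eqF.
Unshelve. all: by end_near. Qed.

End EntropyAtZero.

Section MeanValue.
Context {R : realType}.
Implicit Types (f df : R -> R) (a b : R).

Let mvt f df a b : a < b -> {within `[a, b], continuous f} ->
  (forall x, a < x < b -> is_derive x 1 f (df x)) ->
  exists2 c, a < c < b & f b - f a = df c * (b - a).
Proof.
move=> ab cf fd.
have fd' x : x \in `]a, b[ -> is_derive x 1 f (df x) by rewrite in_itv/=; exact: fd.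
have [c] := MVT ab fd' cf.
by rewrite in_itv/= => h1 h2; exists c.
Qed.

Lemma mvt_gt f df a b : a < b -> {within `[a, b], continuous f} ->
  (forall x, a < x < b -> is_derive x 1 f (df x)) -> f a < f b ->
  exists2 c, a < c < b & 0 < df c.
Proof.
move=> ab cf fd fab; have [c cab e] := mvt ab cf fd; exists c => //.
by rewrite -(pmulr_lgt0 _ (_ : 0 < b - a)) ?subr_gt0// -e subr_gt0.
Qed.

Lemma mvt_ge f df a b : a < b -> {within `[a, b], continuous f} ->
  (forall x, a < x < b -> is_derive x 1 f (df x)) -> f a <= f b ->
  exists2 c, a < c < b & 0 <= df c.
Proof.
move=> ab cf fd fab; have [c cab e] := mvt ab cf fd; exists c => //.
by rewrite -(pmulr_lge0 _ (_ : 0 < b - a)) ?subr_gt0// -e subr_ge0.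
Qed.

Lemma mvt_lt f df a b : a < b -> {within `[a, b], continuous f} ->
  (forall x, a < x < b -> is_derive x 1 f (df x)) -> f b < f a ->
  exists2 c, a < c < b & df c < 0.
Proof.
move=> ab cf fd fab; have [c cab e] := mvt ab cf fd; exists c => //.
by rewrite -(pmulr_llt0 _ (_ : 0 < b - a)) ?subr_gt0// -e subr_lt0.
Qed.

Lemma mvt_le f df a b : a < b -> {within `[a, b], continuous f} ->
  (forall x, a < x < b -> is_derive x 1 f (df x)) -> f b <= f a ->
  exists2 c, a < c < b & df c <= 0.
Proof.
move=> ab cf fd fab; have [c cab e] := mvt ab cf fd; exists c => //.
by rewrite -(pmulr_lle0 _ (_ : 0 < b - a)) ?subr_gt0// -e subr_le0.
Qed.

Lemma is_derive_within f df a b :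
  (forall x, a <= x <= b -> is_derive x 1 f (df x)) -> {within `[a, b], continuous f}.
Proof.
move=> fd; apply: derivable_within_continuous => x.
rewrite in_itv/= => /fd h; exact: ex_derive.
Qed.

Lemma is_derive_continuous f (d x : R) : is_derive x 1 f d -> {for x, continuous f}.
Proof. by move=> h; apply/differentiable_continuous/derivable1_diffP/ex_derive. Qed.

End MeanValue.

Section TangentLines.
Context {R : realType}.
Variables p q : R.
Hypotheses (p_range : 0 < p < 2^-1) (q_range : 0 < q < 2^-1).
Implicit Types r x s c : R.

Let dg r : 0 < r <= 2^-1 -> is_derive r 1 (g_rate q) (dg_rate q r).
Proof. by move=> /andP[r0 r1]; apply: is_derive_g_rate => //; apply/andP; split=> //; lra. Qed.
Let ddg r : 0 < r <= 2^-1 -> is_derive r 1 (dg_rate q) (ddg_rate q r).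
Proof. by move=> /andP[r0 r1]; apply: is_derive_dg_rate => //; apply/andP; split=> //; lra. Qed.
Let df r : 0 <= r <= 2^-1 -> is_derive r 1 (f_rel p q) (df_rel p q r).
Proof. by move=> /andP[r0 r1]; apply: is_derive_f_rel => //; apply/andP; split=> //; lra. Qed.
Let ddf r : 0 <= r <= 2^-1 -> is_derive r 1 (df_rel p q) (ddf_rel p q r).
Proof. by move=> /andP[r0 r1]; apply: is_derive_df_rel => //; apply/andP; split=> //; lra. Qed.

(** The derivative vanishes at 1/2 and is strictly increasing before it. *)
Lemma dg_rate_lt0 r : 0 < r < 2^-1 -> dg_rate q r < 0.
Proof.
move=> /andP[r0 r1]; rewrite ltNge; apply/negP => h.
have [|x /andP[x0 x1]||c /andP[c0 c1]] := mvt_le r1 (df := ddg_rate q) (f := dg_rate q).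
- by apply: (@is_derive_within _ _ (ddg_rate q)) => x /andP[x0 x1]; apply: ddg; lra.
- by apply: ddg; lra.
- by rewrite (dg_rate_half q).
- by rewrite leNgt ddg_rate_gt0//; lra.
Qed.

Lemma df_rel_lt0 r : 0 <= r < 2^-1 -> df_rel p q r < 0.
Proof.
move=> /andP[r0 r1]; rewrite ltNge; apply/negP => h.
have [|x /andP[x0 x1]||c /andP[c0 c1]] := mvt_le r1 (df := ddf_rel p q) (f := df_rel p q).
- by apply: (@is_derive_within _ _ (ddf_rel p q)) => x /andP[x0 x1]; apply: ddf; lra.
- by apply: ddf; lra.
- by rewrite (df_rel_half p q).
- by rewrite leNgt ddf_rel_gt0//; lra.
Qed.

Lemma g_rate_within : {within `[0, 2^-1], continuous (g_rate q)}.
Proof.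
apply/continuous_within_itvP => //; split.
- move=> r; rewrite in_itv/= => /andP[r0 r1].
  by apply: (@is_derive_continuous _ _ (dg_rate q r)); apply: dg; lra.
- have -> : g_rate q 0 = h2 (bconv 0 q) - 0 by rewrite /g_rate h20.
  apply: cvgB; last exact: h2_cvg0.
  apply: cvg_at_right_filter.
  have q01 : 0 < q < 1 by move: q_range => /andP[q0 q1]; lra.
  have z01 : 0 <= (0 : R) <= 1 by rewrite lexx ler01.
  exact: (is_derive_continuous (is_derive_h2_bconv q01 z01)).
- apply: cvg_at_left_filter.
  by apply: (@is_derive_continuous _ _ (dg_rate q 2^-1)); apply: dg; lra.
Qed.

Lemma g_rate_decr r s : 0 <= r -> r < s -> s <= 2^-1 -> g_rate q s < g_rate q r.
Proof.
move=> r0 rs s1; rewrite ltNge; apply/negP => h.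
have [|x /andP[x0 x1]|c /andP[c0 c1]] := mvt_ge rs (df := dg_rate q) _ _ h.
- apply: continuous_subspaceW g_rate_within; apply: subset_itv; rewrite bnd_simp//.
- by apply: dg; lra.
- by rewrite leNgt dg_rate_lt0//; lra.
Qed.

Lemma f_rel_within : {within `[0, 2^-1], continuous (f_rel p q)}.
Proof. exact: (is_derive_within df). Qed.

Lemma f_rel_decr r s : 0 <= r -> r < s -> s <= 2^-1 -> f_rel p q s < f_rel p q r.
Proof.
move=> r0 rs s1; rewrite ltNge; apply/negP => h.
have [|x /andP[x0 x1]|c /andP[c0 c1]] := mvt_ge rs (df := df_rel p q) _ _ h.
- apply: continuous_subspaceW f_rel_within; apply: subset_itv; rewrite bnd_simp//.
- by apply: df; lra.
- by rewrite leNgt df_rel_lt0//; lra.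
Qed.

(** The intermediate value theorem gives a preimage and strict decrease makes it unique, so the
    partial inverse returns that point and not its default 0. *)
Lemma ginv_spec rate : 0 <= rate <= h2 q ->
  0 <= ginv q rate <= 2^-1 /\ g_rate q (ginv q rate) = rate.
Proof.
move=> /andP[R0 R1].
have [||r rI rE] := @IVT _ (g_rate q) 0 2^-1 rate _ g_rate_within.
- by rewrite invr_ge0.
- by rewrite g_rate0 (g_rate_half q) min_r ?max_l ?R0 ?R1 ?(le_trans R0).
have inj : {in `[0, 2^-1]%classic &, injective (g_rate q)}.
  move=> x y; rewrite !inE/= !in_itv/= => /andP[x0 x1] /andP[y0 y1] e.
  have [xy|xy|//] := ltgtP x y.
    by have := g_rate_decr x0 xy y1; rewrite e ltxx.
  by have := g_rate_decr y0 xy x1; rewrite e ltxx.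
have -> : ginv q rate = r.
  rewrite -rE /ginv; apply: pinvKV => //.
  by rewrite inE.
by split=> //; move: rI; rewrite in_itv.
Qed.

Section Tangent.
Variables (c rc : R).
Hypotheses (c_gt0 : 0 < c) (rc_range : 0 < rc < 2^-1).
(** The intercept, at rate zero, of the line of slope [c] through the point of parameter r. A
    maximum of [G] is the least M with f <= c g + M. *)
Let G r : R := f_rel p q r - c * g_rate q r.
Let dG r : R := df_rel p q r - c * dg_rate q r.
Let ddG r : R := ddf_rel p q r - c * ddg_rate q r.

Let Gd r : 0 < r <= 2^-1 -> is_derive r 1 G (dG r).
Proof.
move=> hr; have hr' : 0 <= r <= 2^-1 by lra.
exact: (is_deriveB (df hr') (is_deriveZ c (dg hr))).
Qed.

Let dGd r : 0 < r <= 2^-1 -> is_derive r 1 dG (ddG r).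
Proof.
move=> hr; have hr' : 0 <= r <= 2^-1 by lra.
exact: (is_deriveB (ddf hr') (is_deriveZ c (ddg hr))).
Qed.

Let Ghalf : G 2^-1 = 0.
Proof. by rewrite /G (f_rel_half p q) (g_rate_half q) mulr0 subrr. Qed.

Let dGhalf : dG 2^-1 = 0.
Proof. by rewrite /dG (df_rel_half p q) (dg_rate_half q) mulr0 subrr. Qed.

Let Gw a b : 0 <= a -> b <= 2^-1 -> {within `[a, b], continuous G}.
Proof.
have W : {within `[0, 2^-1], continuous G}.
  move=> x; apply: cvgB; first exact: f_rel_within.
  by apply: cvgMr; exact: g_rate_within.
by move=> a0 b1; apply: continuous_subspaceW W; apply: subset_itv; rewrite bnd_simp.
Qed.

Let dGw a b : 0 < a -> b <= 2^-1 -> {within `[a, b], continuous dG}.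
Proof. by move=> a0 b1; apply: (@is_derive_within _ _ ddG) => x hx; apply: dGd; lra. Qed.

Let pat r1 r2 r3 : 0 < r3 -> r3 < r2 -> r2 < r1 -> r1 < 2^-1 ->
  0 <= ddG r1 -> ddG r2 <= 0 -> 0 < ddG r3 -> False.
Proof. exact: ddf_ddg_pattern. Qed.

                                                                             
                                                             
(** If G' were negative at s, it would have to climb to 0 at [rc], so G'' > 0 somewhere between.
    Since G(rc) >= 0 = G(1/2), G' is nonpositive somewhere in (rc, 1/2); as G' vanishes at both
    ends, G'' is nonpositive before that point and nonnegative after it. This is the excluded
    pattern. *)
Let no_interior s : 0 < s < rc -> dG rc = 0 -> 0 <= G rc -> dG s < 0 -> False.
Proof.
move: rc_range => /andP[rc0 rc1] /andP[s0 s1] drc Grc ds.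
have [|||x3 /andP[x30 x31] h3] := mvt_gt s1 (f := dG) (df := ddG).
- by apply: dGw => //; exact: ltW.
- by move=> x hx; apply: dGd; lra.
- by rewrite drc.
have [|||s1' /andP[s10 s11] hs1] := mvt_le rc1 (f := G) (df := dG).
- by apply: Gw => //; exact: ltW.
- by move=> x hx; apply: Gd; lra.
- by rewrite Ghalf.
have [|||x1 /andP[x10 x11] h1] := mvt_ge s11 (f := dG) (df := ddG).
- by apply: dGw => //; lra.
- by move=> x hx; apply: dGd; lra.
- by rewrite dGhalf.
have [|||x2 /andP[x20 x21] h2] := mvt_le s10 (f := dG) (df := ddG).
- by apply: dGw => //; lra.
- by move=> x hx; apply: dGd; lra.
- by rewrite drc.
by apply: (@pat x1 x2 x3) => //; lra.
Qed.

(** By symmetry r lies in [0, 1/2]. A larger value of G left of [rc] would make G' negative there,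
    against [no_interior]. A larger value at r right of [rc] would make G' positive between [rc] and
    r and negative between r and 1/2; since G' vanishes at [rc] and 1/2, G'' would show the excluded
    pattern. *)
Lemma tangent_max r : df_rel p q rc = c * dg_rate q rc ->
  0 <= f_rel p q rc - c * g_rate q rc -> 0 <= r <= 1 ->
  f_rel p q r - c * g_rate q r <= f_rel p q rc - c * g_rate q rc.
Proof.
move=> drc0 Grc; have drc : dG rc = 0 by rewrite /dG drc0 subrr.
move: rc_range => /andP[rc0 rc1].
rewrite -!/(G _).
suff main r' : 0 <= r' <= 2^-1 -> G r' <= G rc.
  move=> /andP[r0 r1]; have [h|h] := leP r 2^-1; first by apply: main; rewrite r0.
  have -> : G r = G (1 - r) by rewrite /G g_rateC f_relC.
  by apply: main; lra.
move=> /andP[r0 r1]; rewrite leNgt; apply/negP => h.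
have [rrc|rrc|e] := ltgtP r' rc; last by rewrite e ltxx in h.
  have [||s /andP[s0 s1] hs] := mvt_lt rrc _ _ h (df := dG).
  - by apply: Gw => //; exact: ltW.
  - by move=> x hx; apply: Gd; lra.
  by apply: (@no_interior s) => //; lra.
have r1' : r' < 2^-1.
  rewrite lt_neqAle r1 andbT; apply/eqP => e.
  by move: h; rewrite e Ghalf ltNge Grc.
have [||s2 /andP[s20 s21] hs2] := mvt_gt rrc _ _ h (df := dG).
- by apply: Gw => //; lra.
- by move=> x hx; apply: Gd; lra.
have [|||s1 /andP[s10 s11] hs1] := mvt_lt r1' (f := G) (df := dG).
- by apply: Gw => //; lra.
- by move=> x hx; apply: Gd; lra.
- by rewrite Ghalf (le_lt_trans Grc).
have [|||x1 /andP[x10 x11] h1] := mvt_gt s11 (f := dG) (df := ddG).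
- by apply: dGw => //; lra.
- by move=> x hx; apply: dGd; lra.
- by rewrite dGhalf.
have s21' : s2 < s1 by lra.
have [|||x2 /andP[x20 x21] h2] := mvt_lt s21' (f := dG) (df := ddG).
- by apply: dGw => //; lra.
- by move=> x hx; apply: dGd; lra.
- by lra.
have [|||x3 /andP[x30 x31] h3] := mvt_gt s20 (f := dG) (df := ddG).
- by apply: dGw => //; lra.
- by move=> x hx; apply: dGd; lra.
- by rewrite drc.
by apply: (@pat x1 x2 x3) => //; lra.
Qed.

(** Because [dg_rate] is negative, this says that f as a function of the rate has slope at most [c]
    at all rates beyond that of [rc]. *)
Lemma tangent_slope r : df_rel p q rc = c * dg_rate q rc ->
  0 <= f_rel p q rc - c * g_rate q rc -> 0 < r < rc ->
  c * dg_rate q r <= df_rel p q r.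
Proof.
move=> drc0 Grc /andP[r0 r1].
rewrite -subr_ge0 leNgt; apply/negP => h.
apply: (@no_interior r) => //; first by rewrite r0.
by rewrite /dG drc0 subrr.
Qed.

(** Here [c] is the slope at r, not at [rc]. If G(r) < 0 <= G(rc), then G' becomes positive between
    r and [rc] after vanishing at r, and nonpositive between [rc] and 1/2 before vanishing at 1/2;
    G'' again shows the excluded pattern. *)
Lemma tangent_intercept r : df_rel p q r = c * dg_rate q r -> 0 < r < rc ->
  0 <= f_rel p q rc - c * g_rate q rc -> 0 <= f_rel p q r - c * g_rate q r.
Proof.
move=> dr0 /andP[r0 rrc] Grc; have drc : dG r = 0 by rewrite /dG dr0 subrr.
move: rc_range => /andP[rc0 rc1].
rewrite -!/(G _) in Grc *.
rewrite leNgt; apply/negP => h.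
have [|||s /andP[s0 s1] hs] := mvt_gt rrc (f := G) (df := dG).
- by apply: Gw => //; lra.
- by move=> x hx; apply: Gd; lra.
- by lra.
have [|||x3 /andP[x30 x31] h3] := mvt_gt s0 (f := dG) (df := ddG).
- by apply: dGw => //; lra.
- by move=> x hx; apply: dGd; lra.
- by rewrite drc.
have [|||s1' /andP[s10 s11] hs1] := mvt_le rc1 (f := G) (df := dG).
- by apply: Gw => //; lra.
- by move=> x hx; apply: Gd; lra.
- by rewrite Ghalf.
have [|||x1 /andP[x10 x11] h1] := mvt_ge s11 (f := dG) (df := ddG).
- by apply: dGw => //; lra.
- by move=> x hx; apply: dGd; lra.
- by rewrite dGhalf.
have ss : s < s1' by lra.
have [|||x2 /andP[x20 x21] h2] := mvt_le ss (f := dG) (df := ddG).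
- by apply: dGw => //; lra.
- by move=> x hx; apply: dGd; lra.
- by lra.
by apply: (@pat x1 x2 x3) => //; lra.
Qed.

End Tangent.

End TangentLines.

                                             

(** * Entropy and conditional entropy on a finite probability space *)

Section FiniteEntropy.
Context {R : realType} {O : finType}.
Variable mu : O -> R.

Definition expect (F : O -> R) : R := \sum_w mu w * F w.
Definition pmass {A : finType} (U : O -> A) (a : A) : R :=
  prob_of mu (fun w => U w == a).
Definition ent {A : finType} (U : O -> A) : R :=
  - expect (fun w => log2 (pmass U (U w))).
                             
(** [cent V U] is H(V|U): the conditioning variable comes second. *)
Definition cent {A B : finType} (V : O -> B) (U : O -> A) : R :=
  ent (fun w => (U w, V w)) - ent U.
Definition indep {A B : finType} (U : O -> A) (V : O -> B) : Prop :=
  forall a b, pmass (fun w => (U w, V w)) (a, b) = pmass U a * pmass V b.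

Hypotheses (mu_ge0 : forall w, 0 <= mu w) (mu_sum1 : \sum_w mu w = 1).

Lemma expectD F G : expect (fun w => F w + G w) = expect F + expect G.
Proof. by rewrite /expect -big_split/=; apply: eq_bigr => w _; rewrite mulrDr. Qed.

Lemma expectN F : expect (fun w => - F w) = - expect F.
Proof. by rewrite /expect -sumrN; apply: eq_bigr => w _; rewrite mulrN. Qed.

Lemma expectB F G : expect (fun w => F w - G w) = expect F - expect G.
Proof. by rewrite expectD expectN. Qed.

Lemma expectZ k F : expect (fun w => k * F w) = k * expect F.
Proof. by rewrite /expect mulr_sumr; apply: eq_bigr => w _; rewrite mulrCA. Qed.

Lemma expect_cst k : expect (fun=> k) = k.
Proof. by rewrite /expect -mulr_suml mu_sum1 mul1r. Qed.

Lemma expect_sum (I : finType) (A : pred I) (F : I -> O -> R) :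
  expect (fun w => \sum_(i | A i) F i w) = \sum_(i | A i) expect (F i).
Proof.
rewrite /expect exchange_big/=; apply: eq_bigr => w _.
by rewrite mulr_sumr.
Qed.

Lemma eq_expect F G : (forall w, 0 < mu w -> F w = G w) -> expect F = expect G.
Proof.
move=> FG; apply: eq_bigr => w _; have := mu_ge0 w.
by rewrite le_eqVlt => /predU1P[<-|/FG ->//]; rewrite !mul0r.
Qed.

Lemma ler_expect F G : (forall w, 0 < mu w -> F w <= G w) -> expect F <= expect G.
Proof.
move=> FG; apply: ler_sum => w _; have := mu_ge0 w.
by rewrite le_eqVlt => /predU1P[<-|w0]; rewrite ?mul0r// ler_pM2l// FG.
Qed.

Section OneVariable.
Context {A : finType}.
Implicit Types (U : O -> A).

Lemma pmass_ge0 U a : 0 <= pmass U a.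
Proof. exact: sumr_ge0. Qed.

Lemma pmass_gt0 U w : 0 < mu w -> 0 < pmass U (U w).
Proof.
move=> w0; rewrite /pmass /prob_of (bigD1 w)//=.
by rewrite ltr_pwDl// sumr_ge0.
Qed.

Lemma expect_pmass U (F : A -> R) : expect (fun w => F (U w)) = \sum_a pmass U a * F a.
Proof.
rewrite /expect (partition_big U xpredT)//=; apply: eq_bigr => a _.
rewrite /pmass /prob_of mulr_suml; apply: eq_bigr => w /eqP ->//.
Qed.

Lemma sum_pmass U : \sum_a pmass U a = 1.
Proof.
rewrite -[RHS](expect_cst 1) (expect_pmass U (fun=> 1)).
by apply: eq_bigr => a _; rewrite mulr1.
Qed.

Lemma pmassE U a : pmass U a = expect (fun w => (U w == a)%:R).
Proof.
rewrite /pmass /prob_of /expect big_mkcond/=; apply: eq_bigr => w _.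
by case: eqP; rewrite ?mulr1 ?mulr0.
Qed.

Lemma entE U : ent U = - \sum_a pmass U a * log2 (pmass U a).
Proof. by rewrite /ent (expect_pmass U (fun a => log2 (pmass U a))). Qed.

End OneVariable.

(** Entropy sees only the partition that a variable induces. Comparing equality tests replaces
    explicit bijections in all later regroupings of variables. *)
Lemma eq_ent {A B : finType} (U : O -> A) (V : O -> B) :
  (forall w w', (U w == U w') = (V w == V w')) -> ent U = ent V.
Proof.
move=> UV; rewrite /ent; congr (- _); apply: eq_bigr => w _.
by congr (_ * log2 _); apply: eq_bigl => w'; rewrite UV.
Qed.

Lemma eq_pmass {A : finType} (U V : O -> A) : U =1 V -> pmass U = pmass V.
Proof.
by move=> UV; apply/funext => a; apply: eq_bigl => w; rewrite UV.
Qed.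

Section TwoVariables.
Context {A B : finType}.
Implicit Types (U : O -> A) (V : O -> B).

Lemma sum_pmass_pair U V a : \sum_b pmass (fun w => (U w, V w)) (a, b) = pmass U a.
Proof.
rewrite /pmass /prob_of [RHS](partition_big V xpredT)//=.
Qed.

Lemma pmass_pair_le U V a b : pmass (fun w => (U w, V w)) (a, b) <= pmass U a.
Proof.
rewrite -(sum_pmass_pair U V) (bigD1 b)//= lerDl sumr_ge0// => c _.
exact: pmass_ge0.
Qed.

Lemma mutual_infoE U V :
  mutual_info mu U V = ent U + ent V - ent (fun w => (U w, V w)).
Proof.
have -> : mutual_info mu U V = expect (fun w =>
    log2 (pmass (fun w => (U w, V w)) (U w, V w) / (pmass U (U w) * pmass V (V w)))).
  rewrite (expect_pmass (fun w => (U w, V w))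
    (fun ab => log2 (pmass (fun w => (U w, V w)) ab / (pmass U ab.1 * pmass V ab.2)))).
  rewrite /mutual_info pair_big; apply: eq_bigr => -[a b] _ /=.
  by congr (_ * log2 (_ / _)); apply: eq_bigl => w; rewrite xpair_eqE.
rewrite /ent opprK -!expectN -!expectD; apply: eq_expect => w w0.
rewrite log2_div ?log2M ?mulr_gt0 ?pmass_gt0//; lra.
Qed.

Lemma centE U V :
  cent V U = expect (fun w => log2 (pmass U (U w) / pmass (fun w => (U w, V w)) (U w, V w))).
Proof.
rewrite /cent /ent opprK -expectN -expectD; apply: eq_expect => w w0.
rewrite log2_div ?pmass_gt0//; lra.
Qed.

                                                                                    
                                                                                
(** Gibbs' inequality: conditional entropy is at most the cross entropy against any subnormalized
    kernel, by log t <= (t - 1)/ln 2. Each upper bound on a conditional entropy below that is not an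
    exact identity comes from a choice of [k]. *)
Lemma cent_le_cross U V (k : A -> B -> R) :
  (forall a b, 0 <= k a b) -> (forall w, 0 < mu w -> 0 < k (U w) (V w)) ->
  (forall a, \sum_b k a b <= 1) ->
  cent V U <= - expect (fun w => log2 (k (U w) (V w))).
Proof.
move=> k0 kp k1; rewrite -subr_le0 opprK centE -expectD.
pose UV w := (U w, V w).
apply: (@le_trans _ _ (expect (fun w =>
    (pmass U (U w) * k (U w) (V w) / pmass UV (UV w) - 1) / ln 2))).
  apply: ler_expect => w w0.
  have h1 := pmass_gt0 U w0; have h2 := pmass_gt0 UV w0; have h3 := kp _ w0.
  rewrite -log2M ?divr_gt0// mulrAC.
  by apply: log2_le_sub1; rewrite divr_gt0// mulr_gt0.
have -> : expect (fun w => (pmass U (U w) * k (U w) (V w) / pmass UV (UV w) - 1) / ln 2)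
   = (ln 2)^-1 * (expect (fun w => pmass U (U w) * k (U w) (V w) / pmass UV (UV w)) - 1).
  rewrite -[X in _ - X](expect_cst 1) -expectB -expectZ.
  by apply: eq_expect => w _; rewrite mulrC.
rewrite pmulr_rle0 ?invr_gt0 ?ln2_gt0// subr_le0.
rewrite (expect_pmass UV (fun ab => pmass U ab.1 * k ab.1 ab.2 / pmass UV ab)).
apply: (@le_trans _ _ (\sum_ab pmass U ab.1 * k ab.1 ab.2)).
  apply: ler_sum => ab _; have [->|n0] := eqVneq (pmass UV ab) 0.
    by rewrite mul0r mulr_ge0// pmass_ge0.
  by rewrite mulrC divfK.
rewrite -(sum_pmass U) -(pair_big xpredT xpredT (fun a b => pmass U a * k a b))/=.
apply: ler_sum => a _; rewrite -mulr_sumr -[leRHS]mulr1.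
by rewrite ler_wpM2l// pmass_ge0.
Qed.

Lemma ent_indep U V : indep U V -> ent (fun w => (U w, V w)) = ent U + ent V.
Proof.
move=> UV; rewrite /ent -!expectN -expectD; apply: eq_expect => w w0.
by rewrite UV log2M ?pmass_gt0// opprD.
Qed.

Lemma expect_indep U V (F : A -> R) (G : B -> R) : indep U V ->
  expect (fun w => F (U w) * G (V w)) = expect (fun w => F (U w)) * expect (fun w => G (V w)).
Proof.
move=> UV; rewrite (expect_pmass (fun w => (U w, V w)) (fun ab => F ab.1 * G ab.2)).
rewrite (expect_pmass U F) (expect_pmass V G) big_distrlr pair_bigA/=.
by apply: eq_bigr => -[a b] _ /=; rewrite UV; ring.
Qed.

Lemma indep_sym U V : indep U V -> indep V U.
Proof.
move=> UV a b; rewrite mulrC -UV; apply: eq_bigl => w.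
by rewrite !xpair_eqE andbC.
Qed.

Lemma cent_ge0 U V : 0 <= cent V U.
Proof.
rewrite centE; have -> : 0 = expect (fun=> 0) by rewrite expect_cst.
apply: ler_expect => w w0; apply: log2_ge0.
have h := pmass_gt0 (fun w => (U w, V w)) w0.
by rewrite ler_pdivlMr// mul1r pmass_pair_le.
Qed.

Lemma cent_indep U V : indep U V -> cent V U = ent V.
Proof. by move=> /ent_indep; rewrite /cent => ->; rewrite addrC addKr. Qed.

End TwoVariables.

Section MoreVariables.
Context {A B C : finType}.
Implicit Types (U : O -> A) (V : O -> B) (W : O -> C).

(** Conditioning on more lowers entropy: the kernel is the conditional law of V given W, read as a
    function of U. *)
Lemma cent_le_fun U V W (g : A -> C) : (forall w, W w = g (U w)) -> cent V U <= cent V W.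
Proof.
move=> WE; pose WV w := (W w, V w).
apply: (@le_trans _ _ (- expect (fun w => log2 (pmass WV (g (U w), V w) / pmass W (g (U w)))))).
  apply: (cent_le_cross (k := fun a b => pmass WV (g a, b) / pmass W (g a))).
  - by move=> a b; rewrite divr_ge0// pmass_ge0.
  - by move=> w w0; rewrite -WE divr_gt0// (pmass_gt0 WV, pmass_gt0 W).
  - move=> a; rewrite -mulr_suml (sum_pmass_pair W V).
    by have [->|n0] := eqVneq (pmass W (g a)) 0; rewrite ?mul0r// divff.
rewrite centE -expectN; apply: ler_expect => w w0; rewrite -WE -log2V ?invf_div//.
by rewrite divr_gt0// (pmass_gt0 WV, pmass_gt0 W).
Qed.

Lemma cent_chain U V W :
  cent (fun w => (V w, W w)) U = cent V U + cent W (fun w => (U w, V w)).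
Proof.
rewrite /cent [RHS]addrC subrKA; congr (_ - _); apply: eq_ent => w w'.
by rewrite !xpair_eqE andbA.
Qed.

End MoreVariables.

Lemma cent_le_card {A B : finType} (U : O -> A) (V : O -> B) : cent V U <= log2 #|B|%:R.
Proof.
have [w0 _|O0] := pickP [pred w : O | true]; last first.
  have : \sum_w mu w = 0 by apply: big1 => w; have := O0 w.
  by rewrite mu_sum1 => /eqP; rewrite oner_eq0.
have B0 : 0 < #|B|%:R :> R by rewrite ltr0n; apply/card_gt0P; exists (V w0).
apply: (le_trans (cent_le_cross (k := fun _ _ => #|B|%:R^-1) _ _ _)).
- by move=> _ _; rewrite invr_ge0 ltW.
- by move=> _ _; rewrite invr_gt0.
- by move=> _; rewrite sumr_const -[leLHS]mulr_natr mulVf ?gt_eqF.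
by rewrite expect_cst log2V// opprK.
Qed.

(** Subadditivity, with the product over i of the conditional laws of the i-th letter as kernel.
    Each letter may be conditioned on its own function [g i] of U. *)
Lemma cent_ffun_le {I A B : finType} {C : I -> finType} (U : O -> A)
    (V : O -> {ffun I -> B}) (g : forall i, A -> C i) :
  cent V U <= \sum_i cent (fun w => V w i) (fun w => g i (U w)).
Proof.
pose W i w := g i (U w); pose WV i w := (W i w, V w i).
pose k i a b := pmass (WV i) (g i a, b) / pmass (W i) (g i a).
have k0 i a b : 0 <= k i a b by rewrite divr_ge0// pmass_ge0.
have kp i w : 0 < mu w -> 0 < k i (U w) (V w i).
  by move=> w0; rewrite divr_gt0// (pmass_gt0 (WV i), pmass_gt0 (W i)).
apply: (le_trans (cent_le_cross (k := fun a (v : {ffun I -> B}) => \prod_i k i a (v i)) _ _ _)).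
- by move=> a v; exact: prodr_ge0.
- by move=> w w0; apply: prodr_gt0 => i _; exact: kp.
- move=> a; rewrite -(bigA_distr_bigA (fun i b => k i a b)).
  apply: prodr_ile1 => i _; rewrite sumr_ge0//= -mulr_suml.
  rewrite (sum_pmass_pair (W i) (fun w => V w i)).
  by have [->|n0] := eqVneq (pmass (W i) (g i a)) 0; rewrite ?mul0r ?ler01// divff.
rewrite -expectN; under [leRHS]eq_bigr do rewrite centE.
rewrite -expect_sum; apply: ler_expect => w w0.
rewrite log2_prod; last by move=> i _; exact: kp.
rewrite -sumrN; apply: ler_sum => i _; rewrite -log2V ?kp//.
by rewrite invf_div.
Qed.

Lemma cent_bool {A : finType} (U : O -> A) (B : O -> bool) :
  cent B U = \sum_a pmass U a * h2 (pmass (fun w => (U w, B w)) (a, true) / pmass U a).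
Proof.
pose UB w := (U w, B w).
rewrite centE (expect_pmass UB (fun ab => log2 (pmass U ab.1 / pmass UB ab))).
rewrite -(pair_bigA _ (fun a b => pmass UB (a, b) * log2 (pmass U a / pmass UB (a, b))))/=.
apply: eq_bigr => a _; rewrite big_bool/=.
have : pmass UB (a, true) + pmass UB (a, false) = pmass U a.
  by rewrite -(sum_pmass_pair U B) big_bool.
have := pmass_ge0 UB (a, true); have := pmass_ge0 UB (a, false).
set x := pmass UB (a, true); set y := pmass UB (a, false); set z := pmass U a.
move=> y0 x0 xyz; have [z0|zn] := eqVneq z 0.
  have [-> ->] : x = 0 /\ y = 0 by split; lra.
  by rewrite z0 !mul0r addr0.
have zp : 0 < z by rewrite lt_neqAle eq_sym zn -xyz addr_ge0.
have key t : 0 <= t -> t * log2 (z / t) = - (z * (t / z * log2 (t / z))).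
  rewrite le_eqVlt => /predU1P[<-|t0]; first by rewrite !mul0r mulr0 oppr0.
  by rewrite -invf_div log2V ?divr_gt0// mulrA [z * _]mulrC divfK// mulrN.
rewrite !key// /h2.
have -> : 1 - x / z = y / z by rewrite -xyz; field; rewrite xyz.
by rewrite mulrBr mulrN.
Qed.

End FiniteEntropy.

                         

(** * Independence, product measures, and the single-letter identities *)

Lemma sum_pair {R : realType} {A B : finType} (F : A * B -> R) :
  \sum_k F k = \sum_a \sum_b F (a, b).
Proof. by rewrite pair_bigA; apply: eq_bigr => -[]. Qed.

Section Independence.
Context {R : realType} {O : finType}.
Variable mu : O -> R.

                                                                                
                     
(** The pair map (w, w') -> (mix w w', mix w' w) is an involution preserving the product of [mu]
    with itself. It turns an event on U and V of the first point into one on U of the first and V of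
    the second, whose mass factors. *)
Lemma indep_mix {A B : finType} (U : O -> A) (V : O -> B) (mix : O -> O -> O) :
  \sum_w mu w = 1 ->
  (forall w w', mix (mix w w') (mix w' w) = w) ->
  (forall w w', mu (mix w w') * mu (mix w' w) = mu w * mu w') ->
  (forall w w', U (mix w w') = U w) -> (forall w w', V (mix w w') = V w') ->
  indep mu U V.
Proof.
move=> mu1 mixK mu_mix Umix Vmix a b.
pose t (ww : O * O) := (mix ww.1 ww.2, mix ww.2 ww.1).
have tK : involutive t by move=> [w w']; rewrite /t/= !mixK.
transitivity (\sum_(ww : O * O | ((U ww.1 == a) && (V ww.1 == b)) && true) mu ww.1 * mu ww.2).
  rewrite -(pair_big (fun w => (U w == a) && (V w == b)) xpredT
     (fun w w' => mu w * mu w'))/=.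
  rewrite /pmass /prob_of; apply: eq_big => [w|w _]; first by rewrite xpair_eqE.
  by rewrite -mulr_sumr mu1 mulr1.
rewrite (reindex_inj (inv_inj tK))/= /pmass /prob_of big_distrlr/= pair_big/=.
apply: eq_big => [[w w']|[w w'] _] /=; first by rewrite Umix Vmix andbT.
exact: mu_mix.
Qed.

Lemma pmass_pair_comp {A B C : finType} (S : O -> A) (K : O -> B) (f : B -> C) s v :
  pmass mu (fun w => (S w, f (K w))) (s, v) =
  \sum_k (f k == v)%:R * pmass mu (fun w => (S w, K w)) (s, k).
Proof.
rewrite -(sum_pmass_pair mu _ K); apply: eq_bigr => k _.
rewrite /pmass /prob_of; case: eqP => fk; rewrite ?mul1r ?mul0r.
  apply: eq_bigl => w; rewrite !xpair_eqE; case: eqP => //= _.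
  by have [->|_] := eqVneq (K w) k; rewrite ?andbF ?fk ?eqxx.
apply: big1 => w; rewrite !xpair_eqE => /andP[/andP[_ /eqP e1] /eqP e2].
by case: fk; rewrite -e2.
Qed.

End Independence.

Section ProductMeasure.
Context {R : realType} {A : finType} {I : finType}.
Variable nu : I -> A -> R.
Hypotheses (nu_ge0 : forall i a, 0 <= nu i a) (nu_sum1 : forall i, \sum_a nu i a = 1).

Definition prod_pmf (w : {ffun I -> A}) : R := \prod_i nu i (w i).

Lemma prod_pmf_ge0 w : 0 <= prod_pmf w.
Proof. exact: prodr_ge0. Qed.

Lemma expect_prod (F : I -> A -> R) :
  expect prod_pmf (fun w => \prod_i F i (w i)) = \prod_i expect (nu i) (F i).
Proof.
rewrite bigA_distr_bigA/=; apply: eq_bigr => w _.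
by rewrite -big_split.
Qed.

Lemma prod_pmf_sum1 : \sum_w prod_pmf w = 1.
Proof.
transitivity (\prod_(i : I) \sum_a nu i a); first by rewrite bigA_distr_bigA.
by apply: big1.
Qed.

Lemma pmass_prod (B : finType) (F : A -> B) v :
  pmass prod_pmf (fun w => [ffun i => F (w i)]) v = \prod_i pmass (nu i) F (v i).
Proof.
rewrite pmassE; under [RHS]eq_bigr do rewrite pmassE.
rewrite -expect_prod; apply: eq_bigr => w _; congr (_ * _).
case: eqP => [<-|neq]; first by rewrite big1// => i _; rewrite ffunE eqxx.
have [i] : exists i, F (w i) != v i.
  apply/existsP; rewrite -negb_forall; apply/negP => /forallP h.
  by apply: neq; apply/ffunP => i; rewrite ffunE; apply/eqP.
by rewrite (bigD1 i)//= => /negbTE ->; rewrite mul0r.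
Qed.

Lemma expect_coord i (F : A -> R) : expect prod_pmf (fun w => F (w i)) = expect (nu i) F.
Proof.
transitivity (expect prod_pmf (fun w => \prod_j (if j == i then F (w j) else 1))).
  apply: eq_bigr => w _; congr (_ * _).
  by rewrite (bigD1 i)//= eqxx big1 ?mulr1// => j /negbTE ->.
rewrite (expect_prod (fun j a => if j == i then F a else 1)) (bigD1 i)//= eqxx.
rewrite [X in _ * X]big1 ?mulr1// => j /negbTE ->.
exact: expect_cst.
Qed.

Lemma pmass_coord i (B : finType) (F : A -> B) b :
  pmass prod_pmf (fun w => F (w i)) b = pmass (nu i) F b.
Proof. by rewrite !pmassE (expect_coord i (fun a => (F a == b)%:R)). Qed.

Lemma indep_prod_mix {B C : finType} (U : {ffun I -> A} -> B) (V : {ffun I -> A} -> C)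
    (mix : I -> A -> A -> A) :
  (forall i a a', mix i (mix i a a') (mix i a' a) = a) ->
  (forall i a a', nu i (mix i a a') * nu i (mix i a' a) = nu i a * nu i a') ->
  (forall w w' : {ffun I -> A}, U [ffun i => mix i (w i) (w' i)] = U w) ->
  (forall w w' : {ffun I -> A}, V [ffun i => mix i (w i) (w' i)] = V w') ->
  indep prod_pmf U V.
Proof.
move=> mixK nu_mix Umix Vmix.
apply: (@indep_mix _ _ _ _ _ _ _
  (fun w w' : {ffun I -> A} => [ffun i => mix i (w i) (w' i)])) => //.
- exact: prod_pmf_sum1.
- by move=> w w'; apply/ffunP => i; rewrite !ffunE.
- move=> w w'; rewrite /prod_pmf -!big_split/=; apply: eq_bigr => i _.
  by rewrite !ffunE.
Qed.

End ProductMeasure.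

Section Noise.
Context {R : realType}.

Definition noise (a : R) (b : bool) : R := if b then a else 1 - a.

Lemma noise_sum1 a : \sum_b noise a b = 1.
Proof. by rewrite big_bool/= addrC subrK. Qed.

Lemma noise_ge0 a b : 0 <= a <= 1 -> 0 <= noise a b.
Proof. by move=> /andP[a0 a1]; case: b; rewrite //= subr_ge0. Qed.

Lemma noise_gt0 a b : 0 < a < 1 -> 0 < noise a b.
Proof. by move=> /andP[a0 a1]; case: b; rewrite //= subr_gt0. Qed.

Definition source_law (p q : R) (x : bool * bool * bool) : R :=
  2^-1 * noise q (x.1.1 (+) x.1.2) * noise p (x.1.1 (+) x.2).

End Noise.

Section SingleLetter.
Context {R : realType} {O C : finType}.
Variable mu : O -> R.
Hypotheses (mu_ge0 : forall w, 0 <= mu w) (mu_sum1 : \sum_w mu w = 1).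
Variables (p q : R).
Hypotheses (p_range : 0 < p < 2^-1) (q_range : 0 < q < 2^-1).
Variables (S : O -> C) (X1 X2 Y : O -> bool).

Let ZW w := (X1 w (+) X2 w, X1 w (+) Y w).

Hypothesis ZW_law : forall z w, pmass mu ZW (z, w) = noise q z * noise p w.
Hypothesis ZW_indep : indep mu ZW (fun w => (S w, X1 w)).

                             
(** The value is 0 when S = s has mass zero; every use carries the weight [pmass mu S s], so this
    default has no effect. *)
Definition posterior (s : C) : R :=
  pmass mu (fun w => (S w, X1 w)) (s, true) / pmass mu S s.

Lemma posterior_range s : 0 <= posterior s <= 1.
Proof.
have S0 := pmass_ge0 mu_ge0 S s.
rewrite /posterior divr_ge0 ?(pmass_ge0 mu_ge0)//=.
have [->|n0] := eqVneq (pmass mu S s) 0; first by rewrite invr0 mulr0 ler01.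
rewrite ler_pdivrMr ?mul1r ?(pmass_pair_le mu_ge0)//.
by rewrite lt_neqAle eq_sym n0.
Qed.

Let joint s x z w : pmass mu (fun o => (S o, (X1 o, ZW o))) (s, (x, (z, w))) =
  pmass mu S s * (noise (posterior s) x * noise q z * noise p w).
Proof.
transitivity (pmass mu (fun o => (ZW o, (S o, X1 o))) ((z, w), (s, x))).
  by apply: eq_bigl => o; rewrite !xpair_eqE/= andbA andbC.
rewrite ZW_indep ZW_law.
have -> : pmass mu (fun o => (S o, X1 o)) (s, x) = pmass mu S s * noise (posterior s) x.
  have tot := sum_pmass_pair mu S X1 s; rewrite big_bool/= in tot.
  rewrite /noise /posterior -tot.
  have := pmass_ge0 mu_ge0 (fun o => (S o, X1 o)) (s, true).
  have := pmass_ge0 mu_ge0 (fun o => (S o, X1 o)) (s, false).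
  set a := pmass _ _ (s, true); set b := pmass _ _ (s, false) => b0 a0.
  have [e|n0] := eqVneq (a + b) 0.
    have [a_eq0 b_eq0] : a = 0 /\ b = 0 by split; lra.
    by rewrite e mul0r; case: x; rewrite -/a -/b ?a_eq0 ?b_eq0.
  by case: x; rewrite -/a -/b; field.
by ring.
Qed.

Let law (D : finType) (f : bool * (bool * bool) -> D) s v :
  pmass mu (fun w => (S w, f (X1 w, ZW w))) (s, v) =
  pmass mu S s * \sum_k (f k == v)%:R *
     (noise (posterior s) k.1 * noise q k.2.1 * noise p k.2.2).
Proof.
rewrite (pmass_pair_comp mu S (fun w => (X1 w, ZW w))) mulr_sumr.
by apply: eq_bigr => -[x [z w]] _; rewrite joint/=; ring.
Qed.

Let sum8 (F : bool * (bool * bool) -> R) :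
  \sum_k F k = F (true, (true, true)) + F (true, (true, false))
    + F (true, (false, true)) + F (true, (false, false))
    + F (false, (true, true)) + F (false, (true, false))
    + F (false, (false, true)) + F (false, (false, false)).
Proof.
by rewrite sum_pair big_bool/= !sum_pair !big_bool/= !addrA.
Qed.

Lemma cent_X1 : cent mu X1 S = \sum_s pmass mu S s * h2 (posterior s).
Proof. exact: cent_bool. Qed.

Lemma cent_X2 : cent mu X2 S = \sum_s pmass mu S s * h2 (bconv (posterior s) q).
Proof.
rewrite cent_bool//; apply: eq_bigr => s _.
have := law (fun k => k.1 (+) k.2.1) s true.
rewrite (eq_pmass mu (V := fun w => (S w, X2 w))); last first.
  by move=> w; rewrite /= addKb.
move=> ->; have [->|n0] := eqVneq (pmass mu S s) 0; first by rewrite !mul0r.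
rewrite mulrAC mulfV// mul1r sum8/=; congr (_ * h2 _).
by rewrite /bconv; ring.
Qed.

Let entZ : ent mu (fun w => X1 w (+) X2 w) = h2 q.
Proof.
rewrite entE big_bool/=.
have zE z : pmass mu (fun w => X1 w (+) X2 w) z = noise q z.
  rewrite -(sum_pmass_pair mu _ (fun w => X1 w (+) Y w)) big_bool/= !ZW_law.
  by rewrite -mulrDr /= addrC subrK mulr1.
by rewrite !zE /h2 /=; ring.
Qed.

Let entT : ent mu (fun w => X2 w (+) Y w) = h2 (bconv p q).
Proof.
have tE t : pmass mu (fun w => X2 w (+) Y w) t = noise (bconv p q) t.
  rewrite (eq_pmass mu (V := fun w => (ZW w).1 (+) (ZW w).2)); last first.
    by move=> w /=; rewrite -[X1 w (+) X2 w]addbC -addbA addKb.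
  rewrite pmassE (expect_pmass _ ZW (fun zw => (zw.1 (+) zw.2 == t)%:R)).
  rewrite sum_pair !big_bool/= !ZW_law.
  by case: t; rewrite /= /bconv; ring.
rewrite entE big_bool/= !tE /h2 /=; ring.
Qed.

(** H(X1|S,X2) = H(X1|S) + H(X2|S,X1) - H(X2|S), and H(X2|S,X1) = H(Z) = h2(q) by independence. The
    two remaining terms average to minus [g_rate]. *)
Lemma cent_X1_X2 :
  cent mu X1 (fun w => (S w, X2 w)) =
  h2 q - \sum_s pmass mu S s * g_rate q (posterior s).
Proof.
have e1 := cent_chain mu S X1 X2; have e2 := cent_chain mu S X2 X1.
have e3 : cent mu (fun w => (X1 w, X2 w)) S = cent mu (fun w => (X2 w, X1 w)) S.
  by congr (_ - _); apply: eq_ent => w w'; rewrite !xpair_eqE [in X in _ && X]andbC.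
have e4 : cent mu X2 (fun w => (S w, X1 w)) = h2 q.
  rewrite -entZ -(cent_indep (U := fun w => (S w, X1 w)) mu_ge0); last first.
    apply: indep_sym => z sx.
    rewrite -(sum_pmass_pair mu _ (fun w => X1 w (+) Y w)).
    rewrite -(sum_pmass_pair mu (fun w => X1 w (+) X2 w) (fun w => X1 w (+) Y w)).
    rewrite mulr_suml; apply: eq_bigr => w _; rewrite -ZW_indep.
    by apply: eq_bigl => o; rewrite !xpair_eqE/= andbAC.
  congr (_ - _); apply: eq_ent => w w'; rewrite !xpair_eqE.
  case: (X1 w) (X1 w') (X2 w) (X2 w') (S w == S w') => [] [] [] [] [] //.
have -> : \sum_s pmass mu S s * g_rate q (posterior s) = cent mu X2 S - cent mu X1 S.
  rewrite cent_X1 cent_X2 -sumrB; apply: eq_bigr => s _.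
  by rewrite /g_rate mulrBr.
move: e1 e2; rewrite -e3 e4 => -> e; lra.
Qed.

(** With T = X2 xor Y = Z xor W, H(Y|S,X2) = H(T|S) + H(X2|S,T) - H(X2|S). T is independent of S,
    which gives h2([bconv p q]); given T and S, X2 is X1 seen through a channel whose crossover
    depends on T, which gives the last two terms of [f_rel]. *)
Lemma cent_Y_X2 :
  cent mu Y (fun w => (S w, X2 w)) =
  h2 (bconv p q) - \sum_s pmass mu S s * f_rel p q (posterior s).
Proof.
pose T w := X2 w (+) Y w.
have e1 := cent_chain mu S X2 Y; have e2 := cent_chain mu S T X2.
have e3 : cent mu (fun w => (X2 w, Y w)) S = cent mu (fun w => (T w, X2 w)) S.
  congr (_ - _); apply: eq_ent => w w'; rewrite !xpair_eqE /T.
  by case: (Y w) (Y w') (X2 w) (X2 w') (S w == S w') => [] [] [] [] [].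
have [/andP[w20 w21]] := bconv_pq_range p_range q_range.
have w2n : bconv p q != 0 by rewrite gt_eqF.
have w1n : 1 - bconv p q != 0 by rewrite gt_eqF//; lra.
have TZW : T =1 (fun w => (ZW w).1 (+) (ZW w).2).
  by move=> w; rewrite /T /= -[X1 w (+) X2 w]addbC -addbA addKb.
have e4 : cent mu T S = h2 (bconv p q).
  rewrite cent_indep// => s t.
  rewrite (eq_pmass mu (V := fun w => (S w, (ZW w).1 (+) (ZW w).2)));
      last by move=> w; rewrite TZW.
  rewrite (law (fun k => k.2.1 (+) k.2.2)) sum8/=; congr (_ * _).
  rewrite (eq_pmass mu TZW) pmassE (expect_pmass _ ZW (fun zw => (zw.1 (+) zw.2 == t)%:R)).
  rewrite sum_pair !big_bool/= !ZW_law.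
  by case: t => /=; ring.
have e5 : cent mu X2 (fun w => (S w, T w)) =
    \sum_s pmass mu S s * ((1 - bconv p q) * h2 (bconv (posterior s) (p * q / (1 - bconv p q)))
      + bconv p q * h2 (bconv (posterior s) (p * (1 - q) / bconv p q))).
  rewrite cent_bool// sum_pair.
  apply: eq_bigr => s _; rewrite big_bool/=.
  have l1 t : pmass mu (fun w => (S w, T w)) (s, t) = pmass mu S s * noise (bconv p q) t.
    rewrite (eq_pmass mu (V := fun w => (S w, (ZW w).1 (+) (ZW w).2)));
      last by move=> w; rewrite TZW.
    rewrite (law (fun k => k.2.1 (+) k.2.2)) sum8/=; congr (_ * _).
    by case: t; rewrite /= /bconv; ring.
  have l2 t : pmass mu (fun w => ((S w, T w), X2 w)) ((s, t), true) = pmass mu S s *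
      (if t then posterior s * (p * (1 - q)) + (1 - posterior s) * (q * (1 - p))
       else posterior s * ((1 - p) * (1 - q)) + (1 - posterior s) * (p * q)).
    transitivity (pmass mu (fun w =>
        (S w, ((ZW w).1 (+) (ZW w).2, X1 w (+) (ZW w).1))) (s, (t, true))).
      by apply: eq_bigl => w; rewrite !xpair_eqE TZW/= addKb andbA.
    rewrite (law (fun k => (k.2.1 (+) k.2.2, k.1 (+) k.2.1))) sum8/=; congr (_ * _).
    by case: t; rewrite !xpair_eqE/=; ring.
  rewrite !l1 !l2/=.
  have [->|n0] := eqVneq (pmass mu S s) 0; first by rewrite !mul0r addr0.
  rewrite [LHS]addrC [in RHS]mulrDr !(mulrA (pmass mu S s)).
  congr (_ * h2 _ + _ * _).
    by rewrite /bconv in w1n *; field; rewrite w1n n0.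
  (* For T = 1 the crossover in [f_rel] is the probability of X2 = X1, so the parameter found is the
     complement of the one displayed. *)
  rewrite -[RHS]h2C; congr h2.
  by rewrite /bconv in w2n *; field; rewrite w2n n0.
have -> : \sum_s pmass mu S s * f_rel p q (posterior s) =
    cent mu X2 S - cent mu X2 (fun w => (S w, T w)).
  rewrite cent_X2 e5 -sumrB; apply: eq_bigr => s _.
  by rewrite /f_rel; ring.
move: e1 e2; rewrite e3 e4 => -> e; lra.
Qed.

End SingleLetter.

                                    

(** * Block source and converse *)

Section Masks.
Context {n : nat} {B : finType} (b0 : B).
Implicit Types x : {ffun 'I_n -> B}.

(** Discarded letters are overwritten by [b0] rather than removed, so prefixes of all lengths share
    one type and entropies of prefixes can be telescoped over k. *)
Definition prefix_ffun (k : nat) x : {ffun 'I_n -> B} :=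
  [ffun j : 'I_n => if (j < k)%N then x j else b0].
Definition mask_ffun (i : 'I_n) x : {ffun 'I_n -> B} :=
  [ffun j => if j == i then b0 else x j].

Lemma prefix_ffun0 x : prefix_ffun 0 x = [ffun=> b0].
Proof. by apply/ffunP => j; rewrite !ffunE. Qed.

Lemma prefix_ffun_full x : prefix_ffun n x = x.
Proof. by apply/ffunP => j; rewrite ffunE ltn_ord. Qed.

Lemma eq_prefix_ffunS (i : 'I_n) x x' : (prefix_ffun i.+1 x == prefix_ffun i.+1 x') =
  (prefix_ffun i x == prefix_ffun i x') && (x i == x' i).
Proof.
apply/eqP/andP => [/ffunP e|[/eqP/ffunP e /eqP ei]].
  split; last by have := e i; rewrite !ffunE ltnSn => ->.
  apply/eqP/ffunP => j; have := e j; rewrite !ffunE ltnS.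
  by case: (ltnP j i) => // /ltnW ->.
apply/ffunP => j; have := e j; rewrite !ffunE ltnS.
by case: (ltngtP j i) => // /val_inj ->.
Qed.

Lemma eq_mask_ffun i x x' :
  (x == x') = (mask_ffun i x == mask_ffun i x') && (x i == x' i).
Proof.
apply/eqP/andP => [->//|[/eqP/ffunP e /eqP ei]].
by apply/ffunP => j; have := e j; rewrite !ffunE; case: eqP => [->|].
Qed.

End Masks.

Section Source.
Context {R : realType}.
Variables p q : R.
Hypotheses (p_range : 0 < p < 2^-1) (q_range : 0 < q < 2^-1).
Local Notation law := (source_law p q).

Let p01 : 0 <= p <= 1. Proof. by move: p_range => /andP[? ?]; lra. Qed.
Let q01 : 0 <= q <= 1. Proof. by move: q_range => /andP[? ?]; lra. Qed.

Lemma source_law_ge0 x : 0 <= law x.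
Proof. by rewrite /source_law !mulr_ge0 ?noise_ge0. Qed.

Let sum8 (F : bool * bool * bool -> R) :
  \sum_k F k = F (true, true, true) + F (true, true, false)
    + F (true, false, true) + F (true, false, false)
    + F (false, true, true) + F (false, true, false)
    + F (false, false, true) + F (false, false, false).
Proof. by rewrite sum_pair sum_pair big_bool/= !big_bool/= !addrA. Qed.

Lemma source_law_sum1 : \sum_x law x = 1.
Proof. by rewrite sum8 /source_law/=; field. Qed.

Let lawE (A : finType) (F : bool * bool * bool -> A) a :
  pmass law F a = \sum_x law x * (F x == a)%:R.
Proof. exact: pmassE. Qed.

Lemma source_law_ZW z w :
  pmass law (fun x => (x.1.1 (+) x.1.2, x.1.1 (+) x.2)) (z, w) = noise q z * noise p w.
Proof. by rewrite lawE sum8 /source_law/=; case: z w => [] [] /=; field. Qed.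

Lemma source_law_X1 b : pmass law (fun x => x.1.1) b = 2^-1.
Proof. by rewrite lawE sum8 /source_law/=; case: b => /=; field. Qed.

Lemma source_law_X2 b : pmass law (fun x => x.1.2) b = 2^-1.
Proof. by rewrite lawE sum8 /source_law/=; case: b => /=; field. Qed.

Lemma source_law_Y b : pmass law (fun x => x.2) b = 2^-1.
Proof. by rewrite lawE sum8 /source_law/=; case: b => /=; field. Qed.

Let ent_uniform (F : bool * bool * bool -> bool) :
  (forall b, pmass law F b = 2^-1) -> ent law F = 1.
Proof. by move=> h; rewrite entE big_bool/= !h log2_half; lra. Qed.

Lemma source_ent_X1X2 : ent law (fun x => x.1) = 1 + h2 q.
Proof.
rewrite entE sum_pair/=.
have h a b : pmass law (fun x => x.1) (a, b) = 2^-1 * noise q (a (+) b).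
  by rewrite lawE sum8 /source_law/=; case: a b => [] [] /=; rewrite ?xpair_eqE/=; field.
have lg b : log2 (2^-1 * noise q b) = log2 (noise q b) - 1.
  have nq : 0 < noise q b by apply: noise_gt0; move: q_range => /andP[? ?]; lra.
  by rewrite log2M// log2_half addrC.
rewrite !big_bool/= ?big_bool/= !h !lg /= /h2; lra.
Qed.

Section Blocks.
Variable n : nat.
Local Notation mu := (@iid_pmf R _ law n).
Local Notation word := {ffun 'I_n -> bool * bool * bool}.
Implicit Types w : word.

Lemma block_pmf_ge0 w : 0 <= mu w.
Proof. by apply: prodr_ge0 => i _; exact: source_law_ge0. Qed.

Lemma block_pmf_sum1 : \sum_w mu w = 1.
Proof. by apply: (@prod_pmf_sum1 _ _ _ (fun=> law)) => i; exact: source_law_sum1. Qed.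

Let mu0 := block_pmf_ge0.
Let mu1 := block_pmf_sum1.

Lemma ent_iid (A : finType) (F : bool * bool * bool -> A) :
  ent mu (fun w => [ffun i => F (w i)]) = n%:R * ent law F.
Proof.
rewrite {1}/ent.
transitivity (- expect mu (fun w => \sum_(i < n) log2 (pmass law F (F (w i))))).
  congr (- _); apply: eq_expect => // w w0.
  rewrite (@pmass_prod _ _ _ (fun=> law)) log2_prod.
    by apply: eq_bigr => i _; rewrite ffunE.
  move=> i _; rewrite ffunE; apply: pmass_gt0; first exact: source_law_ge0.
  rewrite lt_neqAle source_law_ge0 andbT eq_sym; apply/eqP => wi.
  by move: w0; rewrite /iid_pmf (bigD1 i)//= wi mul0r ltxx.
rewrite expect_sum.
under eq_bigr do rewrite (@expect_coord _ _ _ (fun=> law) (fun=> source_law_sum1) _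
  (fun x => log2 (pmass law F (F x)))).
by rewrite sumr_const card_ord -[X in - X]mulr_natl mulrN.
Qed.

Lemma ent_block_Y : ent mu block_Y = n%:R.
Proof. by rewrite (ent_iid (fun x => x.2)) (ent_uniform source_law_Y) mulr1. Qed.

Lemma ent_block_X2 : ent mu block_X2 = n%:R.
Proof. by rewrite (ent_iid (fun x => x.1.2)) (ent_uniform source_law_X2) mulr1. Qed.

Lemma ent_block_X1X2 : ent mu (fun w => (block_X1 w, block_X2 w)) = n%:R * (1 + h2 q).
Proof.
rewrite -source_ent_X1X2 -(ent_iid (fun x => x.1)); apply: eq_ent => w w'.
rewrite xpair_eqE; apply/andP/eqP => [[/eqP/ffunP e1 /eqP/ffunP e2]|/ffunP e].
  apply/ffunP => i; have := e1 i; have := e2 i; rewrite !ffunE.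
  by case: (w i) (w' i) => [[? ?] ?] [[? ?] ?]/= -> ->.
by split; apply/eqP/ffunP => i; have := e i; rewrite !ffunE => ->.
Qed.

Lemma pmass_block_X1 x : pmass mu block_X1 x = 2^-1 ^+ n.
Proof.
rewrite (@pmass_prod _ _ _ (fun=> law) _ (fun x => x.1.1)).
by under eq_bigr do rewrite source_law_X1; rewrite prodr_const card_ord.
Qed.

Lemma pmass_block_X2 x : pmass mu block_X2 x = 2^-1 ^+ n.
Proof.
rewrite (@pmass_prod _ _ _ (fun=> law) _ (fun x => x.1.2)).
by under eq_bigr do rewrite source_law_X2; rewrite prodr_const card_ord.
Qed.

Definition noise_pair (i : 'I_n) w : bool * bool :=
  ((w i).1.1 (+) (w i).1.2, (w i).1.1 (+) (w i).2).

Lemma noise_pair_law i z t : pmass mu (noise_pair i) (z, t) = noise q z * noise p t.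
Proof.
rewrite -source_law_ZW.
exact: (@pmass_coord _ _ _ (fun=> law) (fun=> source_law_sum1) i _
  (fun x => (x.1.1 (+) x.1.2, x.1.1 (+) x.2))).
Qed.

(** The mixing map transplants Z_i and W_i from one word to the other while keeping X1; a variable
    that reads only X1 and X2 off i does not notice. *)
Lemma noise_pair_indep i (A : finType) (V : word -> A) :
  (forall w w', (forall j, (w j).1.1 = (w' j).1.1) ->
     (forall j, j != i -> (w j).1.2 = (w' j).1.2) -> V w = V w') ->
  indep mu (noise_pair i) V.
Proof.
move=> VE.
pose mix j (a b : bool * bool * bool) : bool * bool * bool :=
  if j == i then ((b.1.1, b.1.1 (+) (a.1.1 (+) a.1.2)), b.1.1 (+) (a.1.1 (+) a.2)) else b.
apply: (@indep_prod_mix _ _ _ (fun=> law) (fun=> source_law_sum1) _ _ _ _ mix).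
- by rewrite /mix => j [[[] []] []] [[[] []] []]; case: eqP.
- rewrite /mix => j a b; case: eqP => _; last exact: mulrC.
  by case: a b => [[[] []] []] [[[] []] []]; rewrite /source_law/=; ring.
- move=> w w'; rewrite /noise_pair !ffunE /mix eqxx.
  by case: (w i) (w' i) => [[[] []] []] [[[] []] []].
- move=> w w'; apply: VE => [j|j ji]; rewrite ffunE /mix.
    by case: eqP => // ->.
  by rewrite (negbTE ji).
Qed.

Definition relevance_noise w : {ffun 'I_n -> bool} := [ffun j => (w j).1.1 (+) (w j).2].

(** Same exchange, now of W on the first k positions, with X1 and X2 kept; Y changes only at those
    positions. *)
Lemma prefix_noise_indep k (A : finType) (V : word -> A) :
  (forall w w', (forall j, (w j).1 = (w' j).1) ->
     (forall j : 'I_n, (k <= j)%N -> (w j).2 = (w' j).2) -> V w = V w') ->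
  indep mu (fun w => prefix_ffun false k (relevance_noise w)) V.
Proof.
move=> VE.
pose mix (j : 'I_n) (a b : bool * bool * bool) : bool * bool * bool :=
  if (j < k)%N then (b.1, b.1.1 (+) (a.1.1 (+) a.2)) else b.
apply: (@indep_prod_mix _ _ _ (fun=> law) (fun=> source_law_sum1) _ _ _ _ mix).
- by rewrite /mix => j [[[] []] []] [[[] []] []]; case: (j < k)%N.
- rewrite /mix => j a b; case: (j < k)%N; last exact: mulrC.
  by case: a b => [[[] []] []] [[[] []] []]; rewrite /source_law/=; ring.
- move=> w w'; apply/ffunP => j; rewrite !ffunE /mix.
  by case: (j < k)%N => //; case: (w j) (w' j) => [[[] []] []] [[[] []] []].
- move=> w w'; apply: VE => [j|j ji]; rewrite ffunE /mix; first by case: ifP.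
  by rewrite ltnNge ji.
Qed.

Section Converse.
Variables (I : finType) (phi : {ffun 'I_n -> bool} -> I).

Let D w := (phi (block_X1 w), block_X2 w).
                                                                       
(** The auxiliary variable of letter i. Omitting X2 at i keeps (S_i, X1_i) independent of the noise
    at i; adding X2 at i recovers exactly the earlier letters of X1, the message and all of X2. *)
Let S (i : 'I_n) w :=
  (prefix_ffun false i (block_X1 w), (phi (block_X1 w), mask_ffun false i (block_X2 w))).

Let S_indep i : indep mu (noise_pair i) (fun w => (S i w, (w i).1.1)).
Proof.
apply: noise_pair_indep => w w' e1 e2.
have -> : S i w = S i w'.
  rewrite /S; have -> : block_X1 w = block_X1 w' by apply/ffunP => j; rewrite !ffunE e1.
  congr (_, (_, _)); apply/ffunP => j; rewrite !ffunE.
  by case: ifPn => // /e2.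
by rewrite e1.
Qed.

Let r i s := posterior mu (S i) (fun w => (w i).1.1) s.

Let eqS (i : 'I_n) w w' :
  ((prefix_ffun false i (block_X1 w), D w) == (prefix_ffun false i (block_X1 w'), D w'))
   = ((S i w, (w i).1.2) == (S i w', (w' i).1.2)).
Proof.
rewrite !xpair_eqE/= (eq_mask_ffun false i (block_X2 w)) !andbA.
by rewrite [block_X2 w i]ffunE [block_X2 w' i]ffunE.
Qed.

(** [F k] is the entropy of the first k letters of X1 with the message and X2. Its increments are
    H(X1_i|S_i,X2_i), and [F n - F 0] is n h2(q) minus H(message|X2). The sum on the left is
    therefore H(message|X2). *)
Lemma converse_rate :
  \sum_(i < n) \sum_s pmass mu (S i) s * g_rate q (r i s) <= log2 #|I|%:R.
Proof.
pose F k := ent mu (fun w => (prefix_ffun false k (block_X1 w), D w)).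
have FS (i : 'I_n) : F i.+1 - F i = h2 q - \sum_s pmass mu (S i) s * g_rate q (r i s).
  rewrite -(cent_X1_X2 mu0 (noise_pair_law i) (S_indep i)).
  congr (_ - _); apply: eq_ent => w w'; last exact: eqS.
  rewrite [RHS]xpair_eqE -eqS !xpair_eqE eq_prefix_ffunS [block_X1 w i]ffunE [block_X1 w' i]ffunE.
  by rewrite andbAC.
have tel := telescope_sumr F (leq0n n).
rewrite big_mkord (eq_bigr _ (fun i _ => FS i)) sumrB sumr_const card_ord in tel.
have Fn : F n = n%:R * (1 + h2 q).
  rewrite -ent_block_X1X2; apply: eq_ent => w w'.
  rewrite !xpair_eqE !prefix_ffun_full.
  by case: eqP => //= ->; rewrite eqxx.
have F0 : F 0%N = n%:R + cent mu (fun w => phi (block_X1 w)) block_X2.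
  rewrite /cent ent_block_X2 addrC subrK; apply: eq_ent => w w'.
  by rewrite !xpair_eqE !prefix_ffun0 eqxx/= andbC.
have := cent_le_card mu0 mu1 block_X2 (fun w => phi (block_X1 w)).
move: tel; rewrite Fn F0 -[h2 q *+ n]mulr_natl; lra.
Qed.

(** The increments of [F] are H(Y_i | earlier Y, D). They only decrease when the earlier letters of
    X1 and W are given instead, since these determine the earlier Y. The earlier W is independent of
    the rest and drops out, leaving H(Y_i|S_i,X2_i). *)
Lemma converse_relevance :
  mutual_info mu block_Y D <=
  n%:R * (1 - h2 (bconv p q)) + \sum_(i < n) \sum_s pmass mu (S i) s * f_rel p q (r i s).
Proof.
pose F k := ent mu (fun w => (prefix_ffun false k (block_Y w), D w)).
have FS (i : 'I_n) : h2 (bconv p q) - \sum_s pmass mu (S i) s * f_rel p q (r i s) <= F i.+1 - F i.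
  rewrite -(cent_Y_X2 mu0 p_range q_range (noise_pair_law i) (S_indep i)).
  pose U w := (prefix_ffun false i (block_X1 w), D w).
  pose V w := (w i).2.
  pose T w := prefix_ffun false i (relevance_noise w).
  have indT : indep mu T (fun w => (U w, V w)).
    apply: prefix_noise_indep => w w' e1 e2.
    have eX1 : block_X1 w = block_X1 w' by apply/ffunP => j; rewrite !ffunE e1.
    have eX2 : block_X2 w = block_X2 w' by apply/ffunP => j; rewrite !ffunE e1.
    by rewrite /U /V /D eX1 eX2 e2.
  have indU : indep mu T U.
    apply: prefix_noise_indep => w w' e1 e2.
    have eX1 : block_X1 w = block_X1 w' by apply/ffunP => j; rewrite !ffunE e1.
    have eX2 : block_X2 w = block_X2 w' by apply/ffunP => j; rewrite !ffunE e1.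
    by rewrite /U /D eX1 eX2.
  have -> : cent mu V (fun w => (S i w, (w i).1.2)) = cent mu V (fun w => (T w, U w)).
    have -> : cent mu V (fun w => (T w, U w)) = cent mu V U.
      rewrite /cent (ent_indep mu0 indU).
      have -> : ent mu (fun w => (T w, U w, V w)) = ent mu (fun w => (T w, (U w, V w))).
        by apply: eq_ent => w w'; rewrite !xpair_eqE !andbA.
      by rewrite (ent_indep mu0 indT); ring.
    congr (_ - _); apply: eq_ent => w w'; last by rewrite -eqS.
    by rewrite [LHS]xpair_eqE -eqS [RHS]xpair_eqE.
  have -> : F i.+1 - F i = cent mu V (fun w => (prefix_ffun false i (block_Y w), D w)).
    congr (_ - _); apply: eq_ent => w w'.
    rewrite !xpair_eqE eq_prefix_ffunS [block_Y w i]ffunE [block_Y w' i]ffunE.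
    by rewrite -!andbA; congr (_ && _); rewrite andbC -andbA.
  pose g (tu : {ffun 'I_n -> bool} * ({ffun 'I_n -> bool} * (I * {ffun 'I_n -> bool}))) :=
    ([ffun j => tu.1 j (+) tu.2.1 j] : {ffun 'I_n -> bool}, tu.2.2).
  apply: (cent_le_fun mu0 mu1 V (g := g)) => w.
  rewrite /g /T /U/=; congr (_, _); apply/ffunP => j; rewrite !ffunE.
  by case: ifP => // _; rewrite addbAC addbb.
have tel := telescope_sumr F (leq0n n); rewrite big_mkord in tel.
have : \sum_(i < n) (h2 (bconv p q) - \sum_s pmass mu (S i) s * f_rel p q (r i s))
    <= \sum_(i < n) (F i.+1 - F i) by apply: ler_sum => i _; exact: FS.
rewrite tel sumrB sumr_const card_ord -[h2 _ *+ n]mulr_natl => H.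
have Fn : F n = ent mu (fun w => (block_Y w, D w)).
  by apply: eq_ent => w w'; rewrite !prefix_ffun_full.
have F0 : F 0%N = ent mu D.
  by apply: eq_ent => w w'; rewrite !xpair_eqE !prefix_ffun0 eqxx.
rewrite (mutual_infoE mu0) ent_block_Y -Fn -F0; lra.
Qed.

Lemma converse_block c M : 0 <= c ->
  (forall x, 0 <= x <= 1 -> f_rel p q x <= c * g_rate q x + M) ->
  mutual_info mu block_Y D <= n%:R * (1 - h2 (bconv p q) + M) + c * log2 #|I|%:R.
Proof.
move=> c0 fgM; apply: (le_trans converse_relevance).
rewrite [n%:R * (_ + M)]mulrDr -addrA lerD2l.
apply: (@le_trans _ _ (n%:R * M +
    c * \sum_(i < n) \sum_s pmass mu (S i) s * g_rate q (r i s))); last first.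
  by rewrite lerD2l ler_wpM2l// converse_rate.
have -> : n%:R * M = \sum_(i < n) \sum_s pmass mu (S i) s * M.
  under eq_bigr do rewrite -mulr_suml (sum_pmass mu1) mul1r.
  by rewrite sumr_const card_ord mulr_natl.
rewrite mulr_sumr -big_split; apply: ler_sum => i _ /=.
rewrite mulr_sumr -big_split; apply: ler_sum => s _ /=.
have -> : pmass mu (S i) s * M + c * (pmass mu (S i) s * g_rate q (r i s))
  = pmass mu (S i) s * (c * g_rate q (r i s) + M) by ring.
by rewrite ler_wpM2l ?(pmass_ge0 mu0)// fgM// (posterior_range mu0).
Qed.

End Converse.
End Blocks.

Theorem converse c M rate m : 0 <= c ->
  (forall x, 0 <= x <= 1 -> f_rel p q x <= c * g_rate q x + M) ->
  achievable law rate m -> m <= 1 - h2 (bconv p q) + M + c * rate.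
Proof.
move=> c0 fgM [rate0 m0 H]; apply/ler_addgt0Pr => e e0.
(* The tolerance enters once through the relevance and [c] times through the rate, [e] in total. A
   single block length suffices. *)
have d0 : 0 < e / (1 + c) by rewrite divr_gt0// ltr_wpDr.
have [n0 /(_ n0.+1 (ltnSn _))[I [phi [h1 h2]]]] := H _ d0.
set n := n0.+1 in I phi h1 h2.
have n_gt0 : 0 < n%:R :> R by rewrite ltr0n.
have := converse_block phi c0 fgM.
rewrite -(ler_pM2l (_ : 0 < n%:R^-1)) ?invr_gt0// => /(le_trans h2).
rewrite mulrDr mulrA mulVf ?gt_eqF// mul1r mulrCA => h3.
have h4 := ler_wpM2l c0 h1.
have : e / (1 + c) + c * (e / (1 + c)) = e by field; rewrite gt_eqF// ltr_wpDr.
lra.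
Qed.

End Source.

                                          

(** * Random binning, covering codes and weighted balls *)

Section ExpectationBounds.
Context {R : realType} {O : finType}.
Variable mu : O -> R.
Hypotheses (mu_ge0 : forall w, 0 <= mu w) (mu_sum1 : \sum_w mu w = 1).

Lemma exists_le_expect (F : O -> R) : exists w, F w <= expect mu F.
Proof.
apply/not_existsP => H.
have : expect mu F < expect mu F; last by rewrite ltxx.
rewrite -[X in X < _](expect_cst mu_sum1).
have [w w0] : exists w, 0 < mu w.
  apply/not_existsP => H'; have : \sum_w mu w = 0.
    by apply: big1 => w _; apply/eqP; rewrite eq_le mu_ge0 leNgt andbT; apply/negP/H'.
  by move/eqP; rewrite mu_sum1 oner_eq0.
rewrite -subr_gt0 -expectB /expect (bigD1 w)//= ltr_pwDl//.
  by rewrite mulr_gt0// subr_gt0 ltNge; apply/negP/H.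
apply: sumr_ge0 => v _; rewrite mulr_ge0// subr_ge0 ltW// ltNge.
exact/negP/H.
Qed.

(** Jensen's inequality, from the tangent of the logarithm at the mean. *)
Lemma expect_log2_le (F : O -> R) : (forall w, 0 < F w) ->
  expect mu (fun w => log2 (F w)) <= log2 (expect mu F).
Proof.
move=> F0; have [w hw] := exists_le_expect F.
have E0 : 0 < expect mu F by rewrite (lt_le_trans (F0 w)).
rewrite -subr_ge0 -[X in X - _](expect_cst mu_sum1) -expectB.
apply: (@le_trans _ _ (expect mu (fun w => (1 - F w / expect mu F) / ln 2))).
  have -> : expect mu (fun w => (1 - F w / expect mu F) / ln 2) =
      (ln 2)^-1 * (1 - (expect mu F)^-1 * expect mu F).
    rewrite -[X in X - _](expect_cst mu_sum1) -expectZ -expectB -expectZ.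
    by apply: eq_expect => // v _; ring.
  by rewrite mulVf ?gt_eqF// subrr mulr0.
apply: ler_expect => // v _; rewrite -log2_div//.
have : log2 (F v / expect mu F) <= (F v / expect mu F - 1) / ln 2.
  by apply: log2_le_sub1; rewrite divr_gt0.
by rewrite !log2_div//; lra.
Qed.

Lemma expect_sqr_sum (I : finType) (A : pred I) (F : I -> O -> R) v :
  (forall i j, A i -> A j -> i != j -> expect mu (fun w => F i w * F j w) = 0) ->
  (forall i, A i -> expect mu (fun w => F i w ^+ 2) <= v) ->
  expect mu (fun w => (\sum_(i | A i) F i w) ^+ 2) <= #|A|%:R * v.
Proof.
move=> F0 Fv.
have -> : expect mu (fun w => (\sum_(i | A i) F i w) ^+ 2) =
    \sum_(i | A i) \sum_(j | A j) expect mu (fun w => F i w * F j w).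
  under [RHS]eq_bigr do rewrite -expect_sum.
  rewrite -expect_sum; apply: eq_expect => // w _.
  by rewrite expr2 big_distrlr.
rewrite mulr_natl -sumr_const; apply: ler_sum => i Ai.
rewrite (bigD1 i)//= big1 ?addr0; first exact: Fv.
by move=> j /andP[Aj ji]; apply: F0 => //; rewrite eq_sym.
Qed.

End ExpectationBounds.

Lemma coord_indep {R : realType} {A I : finType} (nu : I -> A -> R) i j :
  (forall i, \sum_a nu i a = 1) -> i != j ->
  indep (prod_pmf nu) (fun w => w i) (fun w => w j).
Proof.
move=> nu1 ij.
apply: (@indep_prod_mix _ _ _ nu nu1 _ _ _ _ (fun l a b => if l == i then a else b)).
- by move=> l a b; case: eqP.
- by move=> l a b; case: eqP => // _; exact: mulrC.
- by move=> w w'; rewrite ffunE eqxx.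
- by move=> w w'; rewrite ffunE eq_sym (negbTE ij).
Qed.

Section RandomBinning.
Context {R : realType} {O A D : finType}.
Variable mu : O -> R.
Hypotheses (mu_ge0 : forall w, 0 <= mu w) (mu_sum1 : \sum_w mu w = 1).
Variables (V : O -> A) (S : O -> D) (C : {set A}) (Q : A -> D -> R) (K : nat).
Hypotheses (V_in : forall w, V w \in C) (Q_gt0 : forall v s, 0 < Q v s).

Local Notation bins := {ffun A -> 'I_K.+1}.
Let unif (_ : A) (_ : 'I_K.+1) : R := K.+1%:R^-1.

Let unif_ge0 v j : 0 <= unif v j. Proof. by rewrite /unif invr_ge0. Qed.
Let unif_sum1 v : \sum_j unif v j = 1.
Proof. by rewrite /unif sumr_const card_ord -[LHS]mulr_natl mulfV// pnatr_eq0. Qed.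

Let collision v v' : v != v' ->
  expect (prod_pmf unif) (fun b : bins => (b v == b v')%:R) = K.+1%:R^-1.
Proof.
move=> vv'.
rewrite (expect_pmass _ (fun b : bins => (b v, b v')) (fun jj => (jj.1 == jj.2)%:R)).
rewrite sum_pair; under eq_bigr => j _.
  rewrite (bigD1 j)//= eqxx mulr1 big1 ?addr0; last first.
    by move=> j' jj'; rewrite eq_sym (negbTE jj') mulr0.
  rewrite (coord_indep unif_sum1 vv') !(pmass_coord unif_sum1 _ id).
  have h (u : A) : pmass (unif u) id j = K.+1%:R^-1.
    by rewrite /pmass /prob_of big_pred1_eq.
  rewrite !h; over.
by rewrite sumr_const card_ord -[LHS]mulr_natl mulrA mulfV ?mul1r// pnatr_eq0.
Qed.

Let T s := \sum_(v in C) Q v s.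
Let Tb (b : bins) j s := \sum_(v in C | b v == j) Q v s.

Let Tb_gt0 (b : bins) w : 0 < Tb b (b (V w)) (S w).
Proof.
rewrite /Tb (bigD1 (V w)) ?V_in ?eqxx//= ltr_pwDl// sumr_ge0// => v _.
exact: ltW.
Qed.

(** The kernel is [Q] normalized over the codewords lying in the announced bin. *)
Let cent_bin (b : bins) : cent mu V (fun w => (b (V w), S w)) <=
  expect mu (fun w => log2 (Tb b (b (V w)) (S w) / Q (V w) (S w))).
Proof.
pose k (js : 'I_K.+1 * D) v : R :=
  if (v \in C) && (b v == js.1) then Q v js.2 / Tb b js.1 js.2 else 0.
have Tb0 j s : 0 <= Tb b j s by apply: sumr_ge0 => v _; exact: ltW.
apply: (le_trans (cent_le_cross mu_ge0 mu_sum1 (k := k) _ _ _)).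
- move=> [j s] v; rewrite /k; case: ifP => // _.
  by rewrite divr_ge0// ltW.
- by move=> w _; rewrite /k V_in eqxx/= divr_gt0.
- move=> [j s]; rewrite /k/= -big_mkcond/= -mulr_suml.
  rewrite -/(Tb b j s); have [->|n0] := eqVneq (Tb b j s) 0; first by rewrite mul0r.
  by rewrite divff.
rewrite -expectN; apply: ler_expect => // w _; rewrite /k V_in eqxx/=.
by rewrite -log2V ?divr_gt0// invf_div.
Qed.

                                                                               
                                                                                    
(** Average over uniform random bins. Two distinct codewords collide with probability 1/(K+1), so
    the expected mass of the bin of V is at most Q(V) + T/(K+1). Jensen moves the average inside the
    logarithm, and some binning does no worse than the average. *)
Lemma random_binning : exists b : bins,
  cent mu V (fun w => (b (V w), S w)) <=
  expect mu (fun w => log2 (1 + (\sum_(v in C) Q v (S w)) / (K.+1%:R * Q (V w) (S w)))).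
Proof.
change (exists b : bins, cent mu V (fun w => (b (V w), S w)) <=
  expect mu (fun w => log2 (1 + T (S w) / (K.+1%:R * Q (V w) (S w))))).
pose F b := expect mu (fun w => log2 (Tb b (b (V w)) (S w) / Q (V w) (S w))).
have P0 := prod_pmf_ge0 unif_ge0; have P1 := prod_pmf_sum1 unif_sum1.
have [b hb] := exists_le_expect P0 P1 F.
exists b; apply: (le_trans (cent_bin b)); apply: (le_trans hb).
have -> : expect (prod_pmf unif) F = expect mu (fun w =>
    expect (prod_pmf unif) (fun b => log2 (Tb b (b (V w)) (S w) / Q (V w) (S w)))).
  rewrite /F /expect; under eq_bigr do rewrite mulr_sumr.
  rewrite exchange_big/=; apply: eq_bigr => w _; rewrite mulr_sumr.
  by apply: eq_bigr => b' _; rewrite mulrCA.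
apply: ler_expect => // w _.
apply: (le_trans (expect_log2_le P0 P1 (fun b => divr_gt0 (Tb_gt0 b w) (Q_gt0 (V w) (S w))))).
apply: ler_log2.
  rewrite -[ltLHS](expect_cst P1 0) -subr_gt0 -expectB.
  have [b' hb'] := exists_le_expect P0 P1 (fun b => Tb b (b (V w)) (S w) / Q (V w) (S w) - 0).
  by apply: lt_le_trans hb'; rewrite subr0 divr_gt0.
have -> : expect (prod_pmf unif) (fun b => Tb b (b (V w)) (S w) / Q (V w) (S w)) =
    (Q (V w) (S w))^-1 *
    expect (prod_pmf unif) (fun b => \sum_(v in C) Q v (S w) * (b v == b (V w))%:R).
  rewrite -expectZ; apply: eq_expect => // b' _; rewrite mulrC; congr (_ * _).
  rewrite /Tb big_mkcondr/=; apply: eq_bigr => v _.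
  by case: eqP; rewrite ?mulr1 ?mulr0.
rewrite expect_sum (bigD1 (V w))//= mulrDr.
have -> : expect (prod_pmf unif) (fun b : bins => Q (V w) (S w) * (b (V w) == b (V w))%:R) =
    Q (V w) (S w).
  rewrite -[RHS](expect_cst P1); apply: eq_bigr => b' _.
  by rewrite eqxx mulr1.
rewrite mulVf ?gt_eqF// lerD2l invfM mulrA [X in _ <= X]mulrC.
rewrite ler_pM2l ?invr_gt0// /T [X in _ <= X / _](bigD1 (V w))//= mulrDl.
rewrite -[leLHS]add0r lerD//; first by rewrite divr_ge0// ltW.
rewrite mulr_suml; apply: ler_sum => v /andP[_ vV].
by rewrite expectZ collision.
Qed.

End RandomBinning.

Section Covering.
Local Open Scope set_scope.
Context {R : realType} {n : nat}.
Local Notation word := {ffun 'I_n -> bool}.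
Implicit Types (x y c : word) (B C : {set word}).

Definition xorw x y : word := [ffun i => x i (+) y i].

Lemma xorwK x y : xorw x (xorw x y) = y.
Proof. by apply/ffunP => i; rewrite !ffunE addKb. Qed.

Definition uncovered B C : {set word} :=
  [set x | [forall c in C, xorw x c \notin B]].

Lemma card_xorw_preim B x : #|[set c | xorw x c \in B]| = #|B|.
Proof.
have -> : [set c | xorw x c \in B] = [set xorw x y | y in B]; last first.
  by rewrite card_imset//; exact: can_inj (xorwK x).
apply/setP => c; rewrite inE; apply/idP/imsetP => [h|[y yB ->]]; last by rewrite xorwK.
by exists (xorw x c); rewrite ?xorwK.
Qed.

Lemma card_word : #|word| = (2 ^ n)%N.
Proof. by rewrite card_ffun card_bool card_ord. Qed.

(** A uniformly random centre covers each word with probability |B|/2^n, so some centre covers at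
    least that fraction of the uncovered words. *)
Lemma covering_step B C : exists c,
  #|uncovered B (c |: C)|%:R <= #|uncovered B C|%:R * (1 - #|B|%:R / 2 ^+ n) :> R.
Proof.
pose U := uncovered B C.
pose N c := #|[set x in U | xorw x c \in B]|.
have sumN : (\sum_c N c = #|U| * #|B|)%N.
  transitivity (\sum_(x in U) #|[set c | xorw x c \in B]|)%N; last first.
    by under eq_bigr do rewrite card_xorw_preim; rewrite sum_nat_const.
  under eq_bigr do rewrite /N -sum1dep_card big_mkcondr/=.
  rewrite exchange_big/=; apply: eq_bigr => x _.
  by rewrite -sum1dep_card [RHS]big_mkcond.
have [c hc] : exists c, (#|U| * #|B| <= N c * 2 ^ n)%N.
  apply/not_existsP => H.
  have : (\sum_c N c * 2 ^ n < \sum_(c : word) #|U| * #|B|)%N.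
    apply: (@leq_trans (\sum_(c : word) (N c * 2 ^ n).+1)%N).
      rewrite (bigD1 [ffun=> false])//= [X in (_ <= X)%N](bigD1 [ffun=> false])//= -addSn.
      by apply: leq_add => //; apply: leq_sum.
    by apply: leq_sum => c _; rewrite ltnNge; apply/negP/H.
  by rewrite -big_distrl/= sumN sum_nat_const card_word mulnC ltnn.
exists c.
have e : (#|uncovered B (c |: C)| + N c = #|U|)%N.
  rewrite /N -(cardsID [set x | xorw x c \in B] U) addnC; congr (_ + _)%N.
    by apply: eq_card => x; rewrite !inE.
  apply: eq_card => x; rewrite !inE; apply/forallP/andP => [H|[h1 /forallP h2] c'].
    split; first by have := H c; rewrite setU11.
    by apply/forallP => c'; apply/implyP => h; have := H c'; rewrite inE h orbT.
  by apply/implyP; rewrite !inE => /predU1P[->//|h]; have := h2 c'; rewrite h.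
rewrite -/U mulrBr mulr1 lerBrDr -[in leRHS]e natrD lerD2l.
by rewrite mulrA ler_pdivrMr ?exprn_gt0// -!natrM -natrX -natrM ler_nat.
Qed.

Lemma covering M B : exists C,
  [/\ [ffun=> false] \in C, (#|C| <= M.+1)%N &
      #|uncovered B C|%:R <= 2 ^+ n * (1 - #|B|%:R / 2 ^+ n) ^+ M :> R].
Proof.
have b1 : 0 <= 1 - #|B|%:R / 2 ^+ n :> R.
  rewrite subr_ge0 ler_pdivrMr ?exprn_gt0// mul1r -natrX ler_nat -card_word.
  exact: max_card.
elim: M => [|M [C [C0 CM CU]]].
  exists [set [ffun=> false]]; split; rewrite ?inE ?cards1// expr0 mulr1.
  by rewrite -natrX ler_nat -card_word max_card.
have [c hc] := covering_step B C; exists (c |: C); split.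
- by rewrite inE C0 orbT.
- by rewrite cardsU1 -(add1n M.+1) leq_add// leq_b1.
- apply: (le_trans hc); rewrite exprSr mulrA.
  by rewrite ler_wpM2r.
Qed.

End Covering.

Section WeightedBall.
Context {R : realType}.
Local Open Scope set_scope.
Variables n k : nat.
Hypothesis kn : (k <= n)%N.
Local Notation word := {ffun 'I_n -> bool}.
Implicit Types (e : word) (r delta : R).

Lemma sum_below (c : R) : \sum_(i < n | (i < k)%N) c = k%:R * c.
Proof.
by rewrite -(big_ord_widen n (fun=> c) kn) sumr_const card_ord mulr_natl.
Qed.

Lemma card_below : #|[pred i : 'I_n | (i < k)%N]|%:R = k%:R :> R.
Proof. by have := sum_below 1; rewrite mulr1 => <-; rewrite -sumr_const. Qed.

Lemma sum_above (c : R) : \sum_(i < n | ~~ (i < k)%N) c = (n%:R - k%:R) * c.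
Proof.
apply/eqP; rewrite mulrBl eq_sym subr_eq addrC -sum_below; apply/eqP.
rewrite -(bigID (fun i : 'I_n => (i < k)%N) xpredT (fun=> c))/=.
by rewrite sumr_const card_ord mulr_natl.
Qed.

                                                                                
Definition weight e : R := \sum_(i < n | (i < k)%N) (e i)%:R.
(** Only the first [k] letters are coded. The others are given the uniform law, so each adds one bit
    to the size of the ball and nothing to that of the code. *)
Definition rate_at r (i : 'I_n) : R := if (i < k)%N then r else 2^-1.
Definition bern r : word -> R := prod_pmf (fun i => noise (rate_at r i)).
Definition weight_ball r delta : {set word} :=
  [set e | `|weight e - k%:R * r| <= n%:R * delta].

Lemma weight_le e : weight e <= k%:R.
Proof. by rewrite -[k%:R]mulr1 -sum_below; apply: ler_sum => i _; case: (e i). Qed.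

Lemma rate_at_range r i : 0 < r < 1 -> 0 < rate_at r i < 1.
Proof. by move=> r01; rewrite /rate_at; case: ifP => // _; apply/andP; split; lra. Qed.

Lemma bern_gt0 r e : 0 < r < 1 -> 0 < bern r e.
Proof. by move=> r01; apply: prodr_gt0 => i _; rewrite noise_gt0// rate_at_range. Qed.

Let nu_ge0 r : 0 < r < 1 -> forall i b, 0 <= noise (rate_at r i) b.
Proof. by move=> r01 i b; rewrite ltW// noise_gt0// rate_at_range. Qed.

Let nu_sum1 r (i : 'I_n) : \sum_b noise (rate_at r i) b = 1.
Proof. exact: noise_sum1. Qed.

Lemma bern_sum1 r : \sum_e bern r e = 1.
Proof. exact: (prod_pmf_sum1 (nu_sum1 r)). Qed.

Lemma log2_bern r e : 0 < r < 1 ->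
  log2 (bern r e) = - ((weight e - k%:R * r) * dh2 r + k%:R * h2 r + (n%:R - k%:R)).
Proof.
move=> r01; rewrite /bern /prod_pmf log2_prod; last first.
  by move=> i _; rewrite noise_gt0// rate_at_range.
rewrite (bigID (fun i : 'I_n => (i < k)%N))/=.
have -> : \sum_(i < n | ~~ (i < k)%N) log2 (noise (rate_at r i) (e i)) = - (n%:R - k%:R).
  rewrite -[RHS]mulrN1 -sum_above; apply: eq_bigr => i /negbTE ki.
  rewrite /rate_at ki -log2_half; congr log2.
  by rewrite /noise; case: (e i) => //; lra.
have -> : \sum_(i < n | (i < k)%N) log2 (noise (rate_at r i) (e i)) =
    \sum_(i < n | (i < k)%N) (- (dh2 r) * (e i)%:R + (r * dh2 r - h2 r)).
  apply: eq_bigr => i ki; rewrite /rate_at ki /noise /h2 /dh2.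
  by case: (e i) => /=; ring.
rewrite big_split/= -mulr_sumr -/(weight e) sum_below; ring.
Qed.

Let variance r : 0 < r < 1 ->
  expect (bern r) (fun e => (weight e - k%:R * r) ^+ 2) <= n%:R / 4.
Proof.
move=> r01; have P0 := prod_pmf_ge0 (nu_ge0 r01); have P1 := bern_sum1 r.
have cE (i : 'I_n) (F : bool -> R) : (i < k)%N ->
    expect (bern r) (fun e => F (e i)) = r * F true + (1 - r) * F false.
  by move=> ki; rewrite (expect_coord (nu_sum1 r)) /expect big_bool/= /rate_at ki.
have -> : expect (bern r) (fun e => (weight e - k%:R * r) ^+ 2) =
   expect (bern r) (fun e => (\sum_(i < n | (i < k)%N) ((e i)%:R - r)) ^+ 2).
  by apply: eq_bigr => e _; rewrite sumrB sum_below.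
apply: (@le_trans _ _ (#|[pred i : 'I_n | (i < k)%N]|%:R * 4^-1)); last first.
  by rewrite card_below ler_pM2r ?invr_gt0// ler_nat.
apply: (expect_sqr_sum P0 (A := [pred i : 'I_n | (i < k)%N])) => [i j ki kj ij|i ki].
  rewrite (expect_indep (fun b : bool => b%:R - r) (fun b : bool => b%:R - r)
    (coord_indep (nu_sum1 r) ij)).
  by rewrite (cE i (fun b : bool => b%:R - r) ki) /=; ring.
rewrite (cE i (fun b : bool => (b%:R - r) ^+ 2) ki) /=.
have := sqr_ge0 (2 * r - 1); lra.
Qed.

(** By Chebyshev, with variance at most n/4, the ball has [bern r] mass at least 1/2 once 2 n
    delta^2 >= 1. Inside the ball [log2_bern] bounds the mass of each word from above, and dividing
    gives the cardinality. *)
Lemma log2_card_ball r delta : 0 < r < 2^-1 -> 0 < delta ->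
  1 <= 2 * n%:R * delta ^+ 2 -> 0 < #|weight_ball r delta|%:R :> R /\
  k%:R * h2 r + (n%:R - k%:R) - n%:R * delta * dh2 r - 1 <= log2 #|weight_ball r delta|%:R.
Proof.
move=> /andP[r0 r1] d0 nd; have r01 : 0 < r < 1 by rewrite r0; lra.
have P0 := prod_pmf_ge0 (nu_ge0 r01); have P1 := bern_sum1 r.
have b0 e : 0 <= bern r e := P0 e.
have n0 : 0 < n%:R :> R.
  by rewrite lt_neqAle ler0n andbT; apply/eqP => h; rewrite -h in nd; lra.
have nd0 : 0 < n%:R * delta by rewrite mulr_gt0.
have dh0 : 0 <= dh2 r by rewrite subr_ge0 ler_log2//; lra.
have half : 2^-1 <= \sum_(e in weight_ball r delta) bern r e.
  have : \sum_(e in weight_ball r delta) bern r e +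
      \sum_(e | e \notin weight_ball r delta) bern r e = 1.
    by rewrite -P1 [RHS](bigID (mem (weight_ball r delta)))/=.
  have : \sum_(e | e \notin weight_ball r delta) bern r e * (n%:R * delta) ^+ 2 <= n%:R / 4.
    apply: le_trans (variance r01).
    rewrite /expect [leRHS](bigID (fun e => e \notin weight_ball r delta))/=.
    rewrite -[leLHS]addr0 lerD//; last first.
      by apply: sumr_ge0 => e _; rewrite mulr_ge0 ?sqr_ge0 ?b0.
    apply: ler_sum => e; rewrite inE -ltNge => he; rewrite ler_wpM2l ?b0//.
    by rewrite -[leRHS]real_normK ?num_real// lerXn2r ?nnegrE ?normr_ge0 ?ltW.
  rewrite -mulr_suml; set z := \sum_(e | _) _ => hz tot.
  suff : z <= 2^-1 by lra.
  have := ler_wpM2l (ltW n0) nd.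
  have z0 : 0 <= z by apply: sumr_ge0 => e _; exact: P0.
  have -> : n%:R * (2 * n%:R * delta ^+ 2) = 2 * (n%:R * delta) ^+ 2 by ring.
  rewrite mulr1 => h1.
  rewrite -(ler_pM2r (_ : 0 < (n%:R * delta) ^+ 2)) ?exprn_gt0//.
  by apply: (le_trans hz); lra.
pose L := n%:R * delta * dh2 r - k%:R * h2 r - (n%:R - k%:R).
have B0 : 0 < #|weight_ball r delta|%:R :> R.
  rewrite ltr0n lt0n; apply/negP => /eqP/eqP; rewrite cards_eq0 => /eqP B0.
  by move: half; rewrite B0 big_set0; lra.
split=> //; pose m := expR (L * ln 2).
have mE : log2 m = L by rewrite /log2 expRK mulfK// gt_eqF// ln2_gt0.
have : 2^-1 <= #|weight_ball r delta|%:R * m.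
  apply: (le_trans half); rewrite mulr_natl -sumr_const; apply: ler_sum => e.
  rewrite inE => /ler_normlP[h1 h2]; rewrite -[leLHS]lnK; last by rewrite posrE bern_gt0.
  rewrite ler_expR -ler_pdivrMr ?ln2_gt0// -/(log2 (bern r e)) log2_bern//.
  rewrite /L; have : - (n%:R * delta) * dh2 r <= (weight e - k%:R * r) * dh2 r.
    by rewrite ler_wpM2r//; lra.
  lra.
move=> /(ler_log2 (_ : 0 < 2^-1)); rewrite invr_gt0 ltr0n => /(_ isT).
by rewrite log2_half log2M ?expR_gt0// mE /L; lra.
Qed.

(** Greedy covering by translates of the ball; the logarithm of the number of centres is about n
    minus that of the size of the ball, which leaves k(1 - h2 r). *)
Lemma quantizer r delta : 0 < r < 2^-1 -> 0 < delta < 1 ->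
  1 <= 2 * n%:R * delta ^+ 2 ->
  exists (C : {set word}) (psi : word -> word),
    [/\ forall x, psi x \in C,
        log2 #|C|%:R <= k%:R * (1 - h2 r) + n%:R * delta * dh2 r + (log2 (2 - ln delta) + 1) &
        #|[set x | xorw x (psi x) \notin weight_ball r delta]|%:R <= delta * 2 ^+ n].
Proof.
move=> r_range /andP[d0 d1] nd.
have [B0 bB] := log2_card_ball r_range d0 nd.
have two0 : 0 < 2 ^+ n :> R by rewrite exprn_gt0.
set B := weight_ball r delta in B0 bB *; pose beta : R := #|B|%:R / 2 ^+ n.
have beta0 : 0 < beta by rewrite divr_gt0.
have beta1 : beta <= 1.
  by rewrite ler_pdivrMr// mul1r -natrX ler_nat -card_word max_card.
pose L := - ln delta; have L0 : 0 <= L by rewrite oppr_ge0 ln_le0// ltW.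
(* With t the integer part of L/beta, (1 - beta)^(t+1) <= exp(-beta (t+1)) <= delta, while the t + 2
   centres number at most (2 + L)/beta. *)
have [t M1 M2] : exists2 t : nat, t%:R <= L / beta & L / beta < t.+1%:R.
  exists (Num.truncn (L / beta)); last exact: truncnS_gt.
  by rewrite truncn_le divr_ge0// ltW.
pose M := t.+1.
have [C [C0 CM CU]] := @covering R n M B.
have C_gt0 : 0 < #|C|%:R :> R by rewrite ltr0n; apply/card_gt0P; eexists; exact: C0.
(* Uncovered words go to the zero word, which [covering] places in [C]. *)
pose psi (x : word) := if [pick c in C | xorw x c \in B] is Some c then c else [ffun=> false].
exists C, psi; split.
- by move=> x; rewrite /psi; case: pickP => // c /andP[].
- have : #|C|%:R <= (2 - ln delta) / beta.
    apply: (@le_trans _ _ M.+1%:R); first by rewrite ler_nat.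
    have : 2 <= 2 / beta by rewrite ler_pdivlMr// ler_piMr.
    have e : M.+1%:R = t%:R + 2 :> R by rewrite /M -[t.+2]addn2 natrD.
    rewrite mulrDl -/L e; lra.
  have p0 : 0 < 2 - ln delta by move: L0; rewrite /L; lra.
  move=> /(ler_log2 C_gt0); rewrite /beta invf_div.
  rewrite log2M ?divr_gt0// log2_div// log2X// log22 mulr1; lra.
- apply: (@le_trans _ _ #|uncovered B C|%:R).
    rewrite ler_nat; apply/subset_leq_card/fintype.subsetP => x; rewrite inE => h; rewrite inE.
    apply/forallP => c; apply/implyP => cC; apply/negP => hc.
    move: h; rewrite /psi; case: pickP => [c' /andP[_ ->]//|/(_ c)].
    by rewrite cC hc.
  apply: (le_trans CU); rewrite mulrC ler_pM2r//.
  have h1 : 0 <= 1 - beta by rewrite subr_ge0.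
  apply: (@le_trans _ _ (expR (- beta) ^+ M)).
    by rewrite lerXn2r ?nnegrE ?expR_ge0// expR_ge1Dx.
  rewrite -expRM_natl -[leRHS]lnK ?posrE// ler_expR.
  by move: M2; rewrite ltr_pdivrMr// /L -/M mulrN lerNl => /ltW.
Qed.

End WeightedBall.

                      

(** * Convexity of [f_rel], and the analysis of the quantize-and-bin code *)

Section ConvexityOfF.
Context {R : realType}.
Variables p q : R.
Hypotheses (p_range : 0 < p < 2^-1) (q_range : 0 < q < 2^-1).
Implicit Types r x : R.

Let df r : 0 <= r <= 1 -> is_derive r 1 (f_rel p q) (df_rel p q r).
Proof. exact: is_derive_f_rel. Qed.

Let ddf r : 0 <= r <= 1 -> is_derive r 1 (df_rel p q) (ddf_rel p q r).
Proof. exact: is_derive_df_rel. Qed.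

Let df_mono x y : 0 <= x -> x < y -> y <= 1 -> df_rel p q x < df_rel p q y.
Proof.
move=> x0 xy y1; rewrite ltNge; apply/negP => h.
have [||c /andP[c0 c1]] := mvt_le xy _ _ h (df := ddf_rel p q).
- by apply: (@is_derive_within _ _ (ddf_rel p q)) => z /andP[z0 z1]; apply: ddf; lra.
- by move=> z /andP[z0 z1]; apply: ddf; lra.
- by rewrite leNgt ddf_rel_gt0//; lra.
Qed.

Lemma f_rel_tangent r x : 0 <= r <= 1 -> 0 <= x <= 1 ->
  f_rel p q r + df_rel p q r * (x - r) <= f_rel p q x.
Proof.
move=> /andP[r0 r1] /andP[x0 x1].
pose F y := f_rel p q y - df_rel p q r * y.
pose dF y := df_rel p q y - df_rel p q r.
suff : F r <= F x by rewrite /F; lra.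
have Fd (y : R) : 0 <= y <= 1 -> is_derive y 1 F (dF y).
  move=> y01; have H : is_derive y 1 (fun z : R => df_rel p q r * z) (df_rel p q r * 1).
    exact: (is_deriveZ (df_rel p q r) (is_derive_id y 1)).
  by have := is_deriveB (df y01) H; rewrite mulr1.
rewrite leNgt; apply/negP => h.
have [xr|rx|e] := ltgtP x r; last by rewrite e ltxx in h.
- have [||c /andP[c0 c1]] := mvt_gt xr _ _ h (df := dF).
  + by apply: (@is_derive_within _ _ dF) => z /andP[z0 z1]; apply: Fd; lra.
  + by move=> z /andP[z0 z1]; apply: Fd; lra.
  + by rewrite ltNge /dF subr_le0 ltW// df_mono//; lra.
- have [||c /andP[c0 c1]] := mvt_lt rx _ _ h (df := dF).
  + by apply: (@is_derive_within _ _ dF) => z /andP[z0 z1]; apply: Fd; lra.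
  + by move=> z /andP[z0 z1]; apply: Fd; lra.
  + by rewrite ltNge /dF subr_ge0 ltW// df_mono//; lra.
Qed.

Lemma f_rel_ge0 x : 0 <= x <= 1 -> 0 <= f_rel p q x.
Proof.
move=> x01; have h : 0 <= (2^-1 : R) <= 1 by apply/andP; split; lra.
by have := f_rel_tangent h x01; rewrite f_rel_half df_rel_half mul0r addr0.
Qed.

End ConvexityOfF.

Section Achievability.
Context {R : realType}.
Local Open Scope set_scope.
Variables p q r : R.
Hypotheses (p_range : 0 < p < 2^-1) (q_range : 0 < q < 2^-1) (r_range : 0 < r < 2^-1).
Local Notation theta := (bconv r q).

Lemma theta_range : 0 < theta < 2^-1.
Proof.
move: q_range r_range => /andP[q0 q1] /andP[r0 r1].
by rewrite /bconv; apply/andP; split; nra.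
Qed.

Let theta01 : 0 < theta < 1.
Proof. by have /andP[t0 t1] := theta_range; rewrite t0; lra. Qed.

Section Block.
Variables (n k : nat) (delta : R).
Hypotheses (kn : (k <= n)%N) (n_gt0 : (0 < n)%N) (delta_range : 0 < delta < 1).
Local Notation mu := (@iid_pmf R _ (source_law p q) n).
Local Notation word := {ffun 'I_n -> bool}.
Variables (C : {set word}) (psi : word -> word) (slack : R).
Hypotheses (psi_in : forall x, psi x \in C) (slack_ge0 : 0 <= slack).
Hypothesis C_small : log2 #|C|%:R <= k%:R * (1 - h2 r) + n%:R * delta * dh2 r + slack.
Hypothesis bad_rare :
  #|[set x | xorw x (psi x) \notin weight_ball n k r delta]|%:R <= delta * 2 ^+ n :> R.

Let mu0 := block_pmf_ge0 p_range q_range (n := n).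
Let mu1 := block_pmf_sum1 p q n.

Let V w := psi (block_X1 w).
Let e w := xorw (block_X1 w) (V w).
Let nR_gt0 : 0 < n%:R :> R. Proof. by rewrite ltr0n. Qed.
Let kR : k%:R <= n%:R :> R. Proof. by rewrite ler_nat. Qed.

Let bad_mass : expect mu (fun w => (e w \notin weight_ball n k r delta)%:R) <= delta.
Proof.
rewrite (expect_pmass _ block_X1 (fun x => (xorw x (psi x) \notin weight_ball n k r delta)%:R)).
under eq_bigr do rewrite (pmass_block_X1 p q).
rewrite -mulr_sumr exprVn mulrC ler_pdivrMr ?exprn_gt0//.
apply: le_trans bad_rare; rewrite -sum1_card natr_sum [leRHS]big_mkcond/=.
apply: ler_sum => x _; rewrite [X in if X then _ else _]finset.in_set.
by case: (xorw x (psi x) \in weight_ball n k r delta).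
Qed.

(** On the ball the excess is at most n delta; off it the trivial bound n applies, and that event
    has mass at most delta. *)
Let excess w : Num.max 0 (weight k (e w) - k%:R * r) <=
  n%:R * delta + n%:R * (e w \notin weight_ball n k r delta)%:R.
Proof.
move: r_range delta_range => /andP[r0 r1] /andP[d0 d1].
have nd : 0 <= n%:R * delta by rewrite mulr_ge0// ltW.
rewrite ge_max; apply/andP; split; first by rewrite addr_ge0// mulr_ge0.
case: (boolP (e w \in _)) => [|_]; rewrite /= ?mulr0 ?mulr1 ?addr0.
  by rewrite inE => /ler_normlP[].
have wk : weight k (e w) <= k%:R :> R by exact: weight_le.
have kr : 0 <= k%:R * r by rewrite mulr_ge0// ltW.
move: kR; lra.
Qed.

Let expect_excess : expect mu (fun w => Num.max 0 (weight k (e w) - k%:R * r)) <= 2 * n%:R * delta.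
Proof.
apply: le_trans (ler_expect mu0 (fun w _ => excess w)) _.
rewrite expectD (expect_cst mu1) expectZ.
have := ler_wpM2l (ltW nR_gt0) bad_mass; lra.
Qed.

Let flip (w : {ffun 'I_n -> bool * bool * bool}) i := (noise_pair i w).1.
(** The part of the distance between codeword and side information due to the noise Z, centred. Its
    summands are uncorrelated although the signs depend on all of X1, because Z is independent of
    X1. *)
Let drift w : R := \sum_(i < n | (i < k)%N) (-1) ^+ (e w i) * ((flip w i)%:R - q).

Let drift_sqr : expect mu (fun w => drift w ^+ 2) <= n%:R / 4.
Proof.
have E (F : bool -> R) i : expect mu (fun w => F (flip w i)) = q * F true + (1 - q) * F false.
  rewrite (expect_pmass _ (noise_pair i) (fun z => F z.1)) sum_pair !big_bool/=.
  by rewrite !(noise_pair_law p q)/=; ring.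
apply: (@le_trans _ _ (#|[pred i : 'I_n | (i < k)%N]|%:R * 4^-1)); last first.
  by rewrite (card_below kn) ler_pM2r ?invr_gt0.
apply: (expect_sqr_sum mu0 (A := [pred i : 'I_n | (i < k)%N])) => [i j ki kj ij|i ki].
  pose G (xz : word * bool) : R := (-1) ^+ (xorw xz.1 (psi xz.1) i)
    * ((-1) ^+ (xorw xz.1 (psi xz.1) j) * (xz.2%:R - q)).
  have ind : indep mu (noise_pair i) (fun w => (block_X1 w, flip w j)).
    apply: noise_pair_indep => w w' e1 e2.
    congr pair; first by apply/ffunP => l; rewrite !ffunE e1.
    by rewrite /flip /noise_pair/= e1 e2// eq_sym.
  have -> : expect mu (fun w => (-1) ^+ (e w i) * ((flip w i)%:R - q) *
        ((-1) ^+ (e w j) * ((flip w j)%:R - q))) =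
      expect mu (fun w => ((noise_pair i w).1%:R - q) * G (block_X1 w, flip w j)).
    by apply: eq_bigr => w _; rewrite /G /e /V/= /flip; congr (_ * _); ring.
  rewrite (expect_indep (fun z : bool * bool => z.1%:R - q) G ind)
    (E (fun b : bool => b%:R - q)) /=.
  by ring.
have -> : expect mu (fun w => ((-1) ^+ (e w i) * ((flip w i)%:R - q)) ^+ 2) =
    expect mu (fun w => ((flip w i)%:R - q) ^+ 2).
  by apply: eq_bigr => w _; rewrite exprMn sqrr_sign mul1r.
rewrite (E (fun b : bool => (b%:R - q) ^+ 2)) /=.
have := sqr_ge0 (2 * q - 1); lra.
Qed.

Let expect_abs_drift : expect mu (fun w => `|drift w|) <= (4 * delta)^-1 + n%:R * delta.
Proof.
move: delta_range => /andP[d0 d1].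
have nd : 0 < n%:R * delta by rewrite mulr_gt0.
(* For a > 0 and x >= 0, x <= x^2/a + a; here a = n delta, and the second moment is at most n/4. *)
apply: (@le_trans _ _ (expect mu (fun w => (n%:R * delta)^-1 * drift w ^+ 2 + n%:R * delta))).
  apply: ler_expect => // w _; rewrite -(ler_pM2l nd) mulrDr mulrA divff ?gt_eqF// mul1r.
  rewrite -[drift w ^+ 2]real_normK ?num_real//.
  set x := `|drift w|; have x0 : 0 <= x by exact: normr_ge0.
  have [h|h] := leP x (n%:R * delta).
    have : n%:R * delta * x <= n%:R * delta * (n%:R * delta) by rewrite ler_wpM2l// ltW.
    have := sqr_ge0 x; lra.
  have : n%:R * delta * x <= x * x by rewrite ler_wpM2r// ltW.
  by rewrite -expr2; have := mulr_gt0 nd nd; lra.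
rewrite expectD (expect_cst mu1) expectZ lerD2r.
have -> : (4 * delta)^-1 = (n%:R * delta)^-1 * (n%:R / 4).
  by field; rewrite !gt_eqF.
by rewrite ler_pM2l ?invr_gt0.
Qed.

(** Codeword xor side information is the quantization error xor Z. Letterwise this is e + (-1)^e Z,
    whose mean over Z is q + (1 - 2q) e, while theta = q + (1 - 2q) r. *)
Let weight_split w : weight k (xorw (V w) (block_X2 w)) - k%:R * theta =
  drift w + (1 - 2 * q) * (weight k (e w) - k%:R * r).
Proof.
rewrite /weight /drift mulrBr mulr_sumr.
have -> : (1 - 2 * q) * (k%:R * r) = \sum_(i < n | (i < k)%N) (1 - 2 * q) * r.
  by rewrite (sum_below kn); ring.
rewrite -(sum_below kn theta) -!sumrB -big_split; apply: eq_bigr => i _ /=.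
rewrite /e /flip /noise_pair /xorw !ffunE /bconv.
by case: (psi _ i) ((w i).1.1) ((w i).1.2) => [] [] [] /=; rewrite ?expr0 ?expr1; ring.
Qed.

(** With about k g(r) bits of bin index, the bin and X2 leave only slack of order n delta plus a
    constant about the codeword. *)
Lemma binned_codeword K :
  k%:R * g_rate q r + n%:R * delta * dh2 r <= log2 K.+1%:R ->
  exists b : {ffun word -> 'I_K.+1},
  cent mu V (fun w => (b (V w), block_X2 w)) <=
  2 + slack + dh2 theta * ((4 * delta)^-1 + 3 * n%:R * delta).
Proof.
move=> K_large.
(* Decoding metric: the likelihood of codeword xor side information under Bernoulli(theta) on the
   coded letters. *)
pose Q (v s : word) := bern k theta (xorw v s).
have Q0 v s : 0 < Q v s by rewrite bern_gt0.
have V_in w : V w \in C by exact: psi_in.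
have [b hb] := random_binning mu0 mu1 block_X2 K V_in Q0.
exists b; apply: (le_trans hb).
pose T s := \sum_(v in C) Q v s.
change (expect mu (fun w => log2 (1 + T (block_X2 w) / (K.+1%:R * Q (V w) (block_X2 w))))
  <= 2 + slack + dh2 theta * ((4 * delta)^-1 + 3 * n%:R * delta)).
have T0 s : 0 <= T s by apply: sumr_ge0 => v _; rewrite ltW.
have C0 : 0 < #|C|%:R :> R.
  by rewrite ltr0n; apply/card_gt0P; exists (psi [ffun=> false]).
have two0 : 0 < 2 ^+ n :> R by rewrite exprn_gt0.
pose tau : R := #|C|%:R / 2 ^+ n.
have tau0 : 0 < tau by rewrite divr_gt0.
have K0 : 0 < K.+1%:R :> R by rewrite ltr0n.
have dt0 : 0 <= dh2 theta.
  by have /andP[t0 t1] := theta_range; rewrite subr_ge0 ler_log2//; lra.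
(* From 1 + xy <= (1 + x)(1 + y). This separates T, whose mean is [tau] since X2 is uniform, from
   the likelihood of the true codeword. *)
apply: (@le_trans _ _ (expect mu (fun w => log2 (1 + T (block_X2 w) / tau)
    + log2 (1 + tau / (K.+1%:R * Q (V w) (block_X2 w)))))).
  apply: ler_expect => // w _; have q0 := Q0 (V w) (block_X2 w).
  have x0 : 0 <= T (block_X2 w) / tau by rewrite divr_ge0// ltW.
  have y0 : 0 <= tau / (K.+1%:R * Q (V w) (block_X2 w)) by rewrite divr_ge0 ?mulr_ge0// ltW.
  rewrite -log2M ?ltr_pwDl//; apply: ler_log2.
    by rewrite ltr_pwDl// divr_ge0// mulr_ge0// ltW.
  have -> : T (block_X2 w) / (K.+1%:R * Q (V w) (block_X2 w)) =
     (T (block_X2 w) / tau) * (tau / (K.+1%:R * Q (V w) (block_X2 w))).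
    by rewrite mulrA divfK// gt_eqF.
  move: x0 y0; set x := _ / tau; set y := tau / _; nra.
rewrite expectD.
have h1 : expect mu (fun w => log2 (1 + T (block_X2 w) / tau)) <= 1.
  have pos w : 0 < 1 + T (block_X2 w) / tau by rewrite ltr_pwDl// divr_ge0// ltW.
  apply: (le_trans (expect_log2_le mu0 mu1 pos)).
  have -> : expect mu (fun w => 1 + T (block_X2 w) / tau) = 2; last by rewrite log22.
  rewrite expectD (expect_cst mu1).
  have -> : expect mu (fun w => T (block_X2 w) / tau) = 1; last by lra.
  rewrite (expect_pmass _ block_X2 (fun s => T s / tau)).
  under eq_bigr do rewrite (pmass_block_X2 p q).
  rewrite -mulr_sumr -mulr_suml /T exchange_big/=.
  have -> : \sum_(v in C) \sum_s Q v s = #|C|%:R.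
    rewrite -sum1_card natr_sum; apply: eq_bigr => v _.
    rewrite -(bern_sum1 n k theta) [RHS](reindex_inj (can_inj (xorwK v)))/=.
    by [].
  by rewrite exprVn /tau; field; rewrite !gt_eqF.
have h2' : expect mu (fun w => log2 (1 + tau / (K.+1%:R * Q (V w) (block_X2 w)))) <=
    expect mu (fun w => (1 + slack) + dh2 theta *
      (`|drift w| + Num.max 0 (weight k (e w) - k%:R * r))).
  apply: ler_expect => // w _.
  set y := tau / _; have q0 := Q0 (V w) (block_X2 w).
  have y0 : 0 < y by rewrite divr_gt0// mulr_gt0.
  set Z := `|drift w| + _.
  have Z0 : 0 <= Z by rewrite addr_ge0// le_max lexx.
  have dZ0 : 0 <= dh2 theta * Z by rewrite mulr_ge0.
  have [y1|y1] := leP y 1.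
    have : log2 (1 + y) <= log2 2 by apply: ler_log2; lra.
    by rewrite log22; move: slack_ge0 dZ0; lra.
  have : log2 (1 + y) <= log2 (2 * y) by apply: ler_log2; lra.
  rewrite log2M// log22 => /le_trans; apply.
  rewrite -addrA lerD2l.
  rewrite /y log2_div ?mulr_gt0// log2M// /tau log2_div// log2X// log22 mulr1.
  rewrite /Q log2_bern// weight_split.
  have hZ : drift w + (1 - 2 * q) * (weight k (e w) - k%:R * r) <= Z.
    rewrite /Z lerD ?ler_norm//.
    set u := weight _ _ - _; move: q_range => /andP[q0' q1'].
    have [u0|u0] := leP 0 u.
      by rewrite ler_piMl//; lra.
    by rewrite mulr_ge0_le0// ?ltW//; lra.
  have := ler_wpM2r dt0 hZ.
  (* In log2 y the terms in k and the delta terms of [C_small] and [K_large] cancel, leaving slack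
     and [dh2 theta] times the deviation of the weight. *)
  move: C_small K_large; rewrite /g_rate; lra.
apply: (le_trans (lerD h1 h2')).
rewrite expectD (expect_cst mu1) expectZ expectD.
have := ler_wpM2l dt0 (lerD expect_abs_drift expect_excess).
lra.
Qed.

(** Subadditivity reduces to single letters conditioned on their codeword letter and side
    information. Uncoded letters contribute f >= 0. For coded ones the tangent to the convex f at r
    bounds the average of f by the letter's error probability, and the total error exceeds k r by at
    most 2 n delta on average. *)
Lemma codeword_relevance : cent mu block_Y (fun w => (V w, block_X2 w)) <=
  n%:R * h2 (bconv p q) - k%:R * f_rel p q r + 2 * n%:R * delta * - df_rel p q r.
Proof.
have h := cent_ffun_le mu0 mu1 (fun w => (V w, block_X2 w)) block_Y
  (fun i vx => (vx.1 i, vx.2 i)).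
apply: (le_trans h) => {h}.
pose S i w := V w i.
have S_indep i : indep mu (noise_pair i) (fun w => (S i w, (w i).1.1)).
  apply: noise_pair_indep => w w' e1 _.
  have -> : S i w = S i w'.
    by rewrite /S /V; congr (psi _ _); apply/ffunP => j; rewrite !ffunE e1.
  by rewrite e1.
pose post i s := posterior mu (S i) (fun w => (w i).1.1) s.
have post01 i s : 0 <= post i s <= 1 by exact: (posterior_range mu0).
have centE' i : cent mu (fun w => block_Y w i) (fun w => (V w i, block_X2 w i)) =
    h2 (bconv p q) - \sum_s pmass mu (S i) s * f_rel p q (post i s).
  rewrite -(cent_Y_X2 mu0 p_range q_range (noise_pair_law p q i) (S_indep i)).
  congr (_ - _); apply: eq_ent => w w'.
    by rewrite !xpair_eqE [block_Y w i]ffunE [block_Y w' i]ffunE ![block_X2 _ _]ffunE.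
  by rewrite !xpair_eqE ?[block_Y _ _]ffunE ![block_X2 _ _]ffunE.
under eq_bigr do rewrite centE'.
rewrite sumrB sumr_const card_ord -[h2 _ *+ n]mulr_natl -addrA lerD2l.
rewrite (bigID (fun i : 'I_n => (i < k)%N))/= opprD.
have above : 0 <= \sum_(i < n | ~~ (i < k)%N) \sum_s pmass mu (S i) s * f_rel p q (post i s).
  apply: sumr_ge0 => i _; apply: sumr_ge0 => s _.
  by rewrite mulr_ge0 ?(pmass_ge0 mu0)// f_rel_ge0.
have r01 : 0 <= r <= 1 by move: r_range => /andP[? ?]; lra.
have below i : f_rel p q r + df_rel p q r * (expect mu (fun w => (e w i)%:R) - r) <=
    \sum_s pmass mu (S i) s * f_rel p q (post i s).
  rewrite big_bool/=.
  have pm b c : pmass mu (fun w => (S i w, (w i).1.1)) (b, c) =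
      pmass mu (S i) b * noise (post i b) c.
    have tot := sum_pmass_pair mu (S i) (fun w => (w i).1.1) b; rewrite big_bool/= in tot.
    rewrite /post /posterior -tot.
    have x0 := pmass_ge0 mu0 (fun w => (S i w, (w i).1.1)) (b, true).
    have y0 := pmass_ge0 mu0 (fun w => (S i w, (w i).1.1)) (b, false).
    have [z|zn] := eqVneq (pmass mu (fun w => (S i w, (w i).1.1)) (b, true) +
       pmass mu (fun w => (S i w, (w i).1.1)) (b, false)) 0.
      by rewrite z mul0r; case: c; lra.
    by case: c => /=; field.
  have -> : expect mu (fun w => (e w i)%:R) =
      pmass mu (S i) true * (1 - post i true) + pmass mu (S i) false * post i false.
    rewrite -[1 - _]/(noise (post i true) false) -[in X in _ + X]/(noise (post i false) true) -!pm.
    rewrite !pmassE -expectD; apply: eq_bigr => w _; congr (_ * _).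
    rewrite !xpair_eqE /e /S !ffunE.
    by case: (V w i) ((w i).1.1) => [] []; rewrite /= ?addr0 ?add0r.
  (* Given a codeword letter 1, the error probability is one minus the posterior; [f_rel] is
     symmetric about 1/2. *)
  have t1 : f_rel p q r + df_rel p q r * (1 - post i true - r) <= f_rel p q (post i true).
    rewrite -[leRHS]f_relC; apply: f_rel_tangent => //.
    by have /andP[? ?] := post01 i true; lra.
  have t2 := f_rel_tangent p_range q_range r01 (post01 i false).
  have := ler_wpM2l (pmass_ge0 mu0 (S i) true) t1.
  have := ler_wpM2l (pmass_ge0 mu0 (S i) false) t2.
  have := sum_pmass mu1 (S i); rewrite big_bool/= => tot h1 h2.
  have -> : f_rel p q r = (pmass mu (S i) true + pmass mu (S i) false) * f_rel p q r.
    by rewrite tot mul1r.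
  have e1 : r = (pmass mu (S i) true + pmass mu (S i) false) * r by rewrite tot mul1r.
  rewrite [X in _ - X]e1; lra.
have : k%:R * f_rel p q r + df_rel p q r * expect mu (fun w => weight k (e w) - k%:R * r) <=
    \sum_(i < n | (i < k)%N) \sum_s pmass mu (S i) s * f_rel p q (post i s).
  have -> : k%:R * f_rel p q r + df_rel p q r * expect mu (fun w => weight k (e w) - k%:R * r) =
      \sum_(i < n | (i < k)%N) (f_rel p q r + df_rel p q r * (expect mu (fun w => (e w i)%:R) - r)).
    rewrite big_split/= (sum_below kn) -mulr_sumr sumrB (sum_below kn).
    by rewrite expectB (expect_cst mu1) expect_sum.
  by apply: ler_sum => i _; exact: below.
have : expect mu (fun w => weight k (e w) - k%:R * r) <= 2 * n%:R * delta.
  apply: le_trans expect_excess; apply: ler_expect => // w _.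
  by rewrite le_max lexx orbT.
have df0 : df_rel p q r <= 0.
  by apply/ltW/df_rel_lt0 => //; move: r_range => /andP[/ltW -> ->].
move=> /(ler_wnM2l df0); lra.
Qed.

End Block.
End Achievability.

                           

(** * The coding theorem: achievable points and evaluation of the supremum *)

Section CodingTheorem.
Context {R : realType}.
Variables p q : R.
Hypotheses (p_range : 0 < p < 2^-1) (q_range : 0 < q < 2^-1).
Local Notation law := (source_law p q).

Let p01 : 0 < p < 1. Proof. by move: p_range => /andP[-> ?]/=; lra. Qed.
Let q01 : 0 < q < 1. Proof. by move: q_range => /andP[-> ?]/=; lra. Qed.

Lemma g_rate_ge0 r : 0 <= r <= 2^-1 -> 0 <= g_rate q r.
Proof.
move=> /andP[r0]; rewrite le_eqVlt => /predU1P[->|r1]; first by rewrite g_rate_half.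
by rewrite -(g_rate_half q) ltW// g_rate_decr.
Qed.

(** At r = 0 the auxiliary variable reveals X1, and only the noise W remains in Y. *)
Lemma f_rel0 : f_rel p q 0 = h2 (bconv p q) - h2 p.
Proof.
have /andP[w0 w1] := bconv_pq_range p_range q_range.
move: (p01) (q01) => /andP[p0 p1] /andP[q0 q1].
have w1' : 0 < 1 - bconv p q by lra.
have b0 (a : R) : bconv 0 a = a by rewrite /bconv; ring.
have p0' : 0 < 1 - p by lra.
have q0' : 0 < 1 - q by lra.
rewrite /f_rel !b0 /h2.
have -> : 1 - p * q / (1 - bconv p q) = (1 - p) * (1 - q) / (1 - bconv p q).
  by rewrite /bconv in w1' *; field; rewrite gt_eqF.
have -> : 1 - p * (1 - q) / bconv p q = q * (1 - p) / bconv p q.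
  by rewrite /bconv in w0 *; field; rewrite gt_eqF.
rewrite !log2_div ?mulr_gt0// !log2M//.
move: (log2 p) (log2 q) (log2 (1 - p)) (log2 (1 - q)) (log2 (bconv p q)) (log2 (1 - bconv p q)).
move=> lp lq lp' lq' lw lw'.
rewrite /bconv in w0 w1' *; field.
by rewrite !gt_eqF.
Qed.

Theorem achievability r lam eta : 0 < r < 2^-1 -> 0 <= lam <= 1 -> 0 < eta ->
  exists n0 : nat, forall n : nat, (n0 < n)%N ->
    exists (I : finType) (phi : {ffun 'I_n -> bool} -> I),
      n%:R^-1 * log2 #|I|%:R <= lam * g_rate q r + eta /\
      1 - h2 (bconv p q) + lam * f_rel p q r - eta <=
        n%:R^-1 * mutual_info (@iid_pmf R _ law n) block_Y
                    (fun w => (phi (block_X1 w), block_X2 w)).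
Proof.
move=> r_range /andP[lam0 lam1] eta0.
have /andP[r0 r1] := r_range.
have r01 : 0 <= r <= 1 by apply/andP; split; lra.
have r02 : 0 <= r <= 2^-1 by apply/andP; split; lra.
have /andP[t0 t1] := theta_range q_range r_range.
set theta := bconv r q in t0 t1.
set l := dh2 r; set lt := dh2 theta; set F := - df_rel p q r.
have l0 : 0 <= l by rewrite subr_ge0 ler_log2//; lra.
have lt0 : 0 <= lt by rewrite subr_ge0 ler_log2//; lra.
have F0 : 0 <= F by rewrite oppr_ge0 ltW// df_rel_lt0//; apply/andP; split=> //; exact: ltW.
have G0 := g_rate_ge0 r02; set G := g_rate q r in G0 *.
have f0 := f_rel_ge0 p_range q_range r01; set f := f_rel p q r in f0 *.
(* Chosen so that delta l and delta (2F + 3 lt), the losses per letter in rate and relevance, are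
   each at most eta/2; the summand eta makes delta < 1. *)
pose den := 2 * (1 + l + 2 * F + 3 * lt + eta).
have den0 : 0 < den by rewrite /den; lra.
pose delta := eta / den.
have d0 : 0 < delta by rewrite divr_gt0.
have dE : delta * den = eta by rewrite divfK// gt_eqF.
have d1 : delta < 1 by rewrite ltr_pdivrMr// mul1r /den; lra.
have d_range : 0 < delta < 1 by rewrite d0.
have dl : delta * l <= eta / 2.
  have : 0 <= delta * (1 + 2 * F + 3 * lt + eta) by apply: mulr_ge0; lra.
  by move: dE; rewrite /den; lra.
have dF : delta * (2 * F + 3 * lt) <= eta / 2.
  have : 0 <= delta * (1 + l + eta) by apply: mulr_ge0; lra.
  by move: dE; rewrite /den; lra.
pose slack := log2 (2 - ln delta) + 1.
have slack0 : 0 <= slack.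
  rewrite addr_ge0// log2_ge0//; have := ln_le0 (ltW d1); lra.
(* The losses that do not grow with n: one bit for rounding the number of bins, f for rounding lam n
   down to k, and the constant part of the binning bound. [X] then makes n large enough for
   Chebyshev and for c1 <= n eta/2. *)
pose c1 := 1 + f + (2 + slack + lt * (4 * delta)^-1).
have c10 : 0 <= c1.
  have : 0 <= lt * (4 * delta)^-1 by rewrite mulr_ge0// invr_ge0 mulr_ge0// ltW.
  rewrite /c1; lra.
pose X := (2 * delta ^+ 2)^-1 + 2 / eta * c1.
have X1 : 0 <= (2 * delta ^+ 2)^-1 by rewrite invr_ge0 mulr_ge0// exprn_ge0// ltW.
have X2 : 0 <= 2 / eta * c1 by rewrite mulr_ge0// divr_ge0// ltW.
exists (Num.truncn X) => n hn.
have n_gt0 : (0 < n)%N by apply: leq_ltn_trans hn.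
have nR : 0 < n%:R :> R by rewrite ltr0n.
have nX : X <= n%:R.
  apply: ltW; apply: (lt_le_trans (truncnS_gt X)).
  by rewrite ler_nat.
have n1 : 1 <= 2 * n%:R * delta ^+ 2.
  have h : (2 * delta ^+ 2)^-1 <= n%:R by apply: le_trans nX; rewrite lerDl.
  have h' : 0 < 2 * delta ^+ 2 by rewrite mulr_gt0// exprn_gt0.
  have := ler_wpM2r (ltW h') h; rewrite mulVf ?gt_eqF//; lra.
have n2 : c1 <= n%:R * (eta / 2).
  have h : 2 / eta * c1 <= n%:R by apply: le_trans nX; rewrite lerDr.
  have h' : 0 < eta / 2 by rewrite divr_gt0.
  have := ler_wpM2r (ltW h') h.
  by have -> : 2 / eta * c1 * (eta / 2) = c1 by field; rewrite gt_eqF.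
have [k k1 k2] : exists2 k : nat, k%:R <= lam * n%:R & lam * n%:R < k.+1%:R.
  exists (Num.truncn (lam * n%:R)); last exact: truncnS_gt.
  by rewrite truncn_le mulr_ge0.
have kn : (k <= n)%N.
  by rewrite -(ler_nat R) (le_trans k1)// ler_piMl// ltW.
have [C [psi [psi_in C_small bad_rare]]] := quantizer kn r_range d_range n1.
pose x := k%:R * G + n%:R * delta * l.
have x0 : 0 <= x by rewrite addr_ge0// mulr_ge0// mulr_ge0// ltW.
pose m := expR (x * ln 2).
have mE : log2 m = x by rewrite /log2 expRK mulfK// gt_eqF// ln2_gt0.
have m1 : 1 <= m by rewrite -expR0 ler_expR mulr_ge0// ltW// ln2_gt0.
have [K K1 K2] : exists2 K : nat, K%:R <= m & m < K.+1%:R.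
  by exists (Num.truncn m); [rewrite truncn_le ltW// expR_gt0 | exact: truncnS_gt].
have K3 : k%:R * G + n%:R * delta * l <= log2 K.+1%:R.
  by rewrite -/x -mE ler_log2 ?expR_gt0// ltW.
have [b hb] := binned_codeword p_range q_range r_range kn n_gt0 d_range
  psi_in slack0 C_small bad_rare K3.
have hY := codeword_relevance p_range q_range r_range kn n_gt0 d_range bad_rare.
exists 'I_K.+1, (fun y => b (psi y)); split.
  rewrite card_ord mulrC ler_pdivrMr//.
  have : log2 K.+1%:R <= log2 (2 * m).
    apply: ler_log2; first by rewrite ltr0n.
    rewrite -natr1; lra.
  rewrite log2M ?expR_gt0// log22 mE /x.
  have : k%:R * G <= lam * n%:R * G by rewrite ler_wpM2r.
  have : n%:R * (delta * l) <= n%:R * (eta / 2) by rewrite ler_pM2l.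
  have : 1 <= c1.
    have : 0 <= lt * (4 * delta)^-1 by rewrite mulr_ge0// invr_ge0 mulr_ge0// ltW.
    rewrite /c1; lra.
  lra.
rewrite [leRHS]mulrC ler_pdivlMr//.
pose mu := @iid_pmf R _ law n; rewrite -/mu.
have mu0 w : 0 <= mu w := block_pmf_ge0 p_range q_range w.
have mu1 : \sum_w mu w = 1 := block_pmf_sum1 p q n.
rewrite (mutual_infoE mu0) (ent_block_Y p_range q_range).
pose V w := psi (@block_X1 n w).
pose D w := (b (V w), @block_X2 n w).
have e1 : ent mu (fun w => (block_Y w, D w)) = ent mu D + cent mu block_Y D.
  by rewrite /cent addrC subrK; apply: eq_ent => w w'; rewrite !xpair_eqE andbC.
rewrite -/(D _) e1.
(* Recovering the codeword first costs H(V|D); afterwards Y is predicted from the codeword and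
   X2. *)
have h1 : cent mu block_Y D <= cent mu V D + cent mu block_Y (fun w => (V w, block_X2 w)).
  apply: (@le_trans _ _ (cent mu (fun w => (V w, block_Y w)) D)).
    have -> : cent mu (fun w => (V w, block_Y w)) D =
        cent mu block_Y D + cent mu V (fun w => (D w, block_Y w)).
      rewrite -(cent_chain mu D block_Y V); congr (_ - _); apply: eq_ent => w w'.
      by rewrite !xpair_eqE [in X in _ && X]andbC.
    by rewrite lerDl cent_ge0.
  rewrite cent_chain lerD2l.
  by apply: (cent_le_fun mu0 mu1 (block_Y) (g := fun dv => (dv.2, dv.1.2))).
have hkf : lam * n%:R * f - f <= k%:R * f.
  have : (lam * n%:R) * f <= k.+1%:R * f by rewrite ler_wpM2r// ltW.
  by rewrite -natr1; lra.
have hnd : n%:R * (delta * (2 * F + 3 * lt)) <= n%:R * (eta / 2) by rewrite ler_pM2l.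
have hc : lt * ((4 * delta)^-1 + 3 * n%:R * delta) =
    lt * (4 * delta)^-1 + 3 * n%:R * delta * lt by ring.
move: hb hY; rewrite -/theta -/lt -/f -/F hc => hb hY.
move: n2; rewrite /c1 => n2.
have := lerD hb hY; rewrite -/V -/D -/mu => h2'.
have := le_trans h1 h2'.
lra.
Qed.

Lemma achievable_point r lam rate : 0 < r < 2^-1 -> 0 <= lam <= 1 ->
  lam * g_rate q r <= rate ->
  achievable law rate (1 - h2 (bconv p q) + lam * f_rel p q r).
Proof.
move=> r_range /andP[lam0 lam1] hr; have /andP[r0 r1] := r_range.
have r01 : 0 <= r <= 1 by apply/andP; split; lra.
have r02 : 0 <= r <= 2^-1 by apply/andP; split; lra.
split.
- by apply: le_trans hr; rewrite mulr_ge0// g_rate_ge0.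
- have /andP[w0 w1] := bconv_pq_range p_range q_range.
  have : h2 (bconv p q) <= 1 by apply: h2_le1; apply/andP; split; lra.
  have : 0 <= lam * f_rel p q r by rewrite mulr_ge0// f_rel_ge0.
  by lra.
- move=> eps eps0; have lam01 : 0 <= lam <= 1 by rewrite lam0.
  have [n0 H] := achievability r_range lam01 eps0.
  exists n0 => n /H[I [phi [h1 h2]]]; exists I, phi; split=> //.
  by apply: (le_trans h1); rewrite lerD2r.
Qed.

Lemma relevance_rateE rate m : achievable law rate m ->
  (forall m', achievable law rate m' -> m' <= m) -> relevance_rate law rate = m.
Proof.
move=> hm ub; apply/eqP; rewrite eq_le; apply/andP; split.
  by apply: ge_sup; [exists m | move=> x /= /ub].
by apply: ub_le_sup => //; exists m => x /= /ub.
Qed.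

                                                                                        
(** Upper bound from the majorant with c = 0 and M = f(0). The code construction needs r > 0, so for
    each tolerance a small r is taken by continuity of f at 0; its rate stays below g(0) = h2(q). *)
Lemma relevance_rate_full rate : h2 q <= rate -> relevance_rate law rate = 1 - h2 p.
Proof.
move=> hq; apply: relevance_rateE; last first.
  move=> m hm.
  have H x : 0 <= x <= 1 -> f_rel p q x <= 0 * g_rate q x + (h2 (bconv p q) - h2 p).
    rewrite mul0r add0r -f_rel0.
    suff main y : 0 <= y <= 2^-1 -> f_rel p q y <= f_rel p q 0.
      move=> /andP[x0 x1]; have [h|h] := leP x 2^-1; first by apply: main; rewrite x0.
      by rewrite -f_relC; apply: main; apply/andP; split; lra.
    move=> /andP[]; rewrite le_eqVlt => /predU1P[<-//|y0 y1].
    by rewrite ltW// f_rel_decr.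
  by have := converse p_range q_range (lexx 0) H hm; lra.
have hp : h2 p <= 1.
  by apply: h2_le1; move: p01 => /andP[/ltW -> /ltW ->].
have hq0 : 0 <= h2 q by apply: h2_ge0; move: q01 => /andP[/ltW -> /ltW ->].
split; [exact: le_trans hq | by rewrite subr_ge0 |].
move=> eps eps0.
have z01 : 0 <= (0 : R) <= 1 by rewrite lexx ler01.
have cf := is_derive_continuous (is_derive_f_rel p_range q_range z01).
have e2 : 0 < eps / 2 by rewrite divr_gt0.
have [r [r_range hr]] : exists r, 0 < r < 2^-1 /\ f_rel p q 0 - eps / 2 < f_rel p q r.
  have /cvgrPdist_lt/(_ _ e2)/nbhs_ballP[d /= d0 hd] := cf.
  exists (Num.min (d / 2) 4^-1).
  have m0 : 0 < Num.min (d / 2) 4^-1 by rewrite lt_min divr_gt0//= invr_gt0.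
  have m1 : Num.min (d / 2) 4^-1 < 2^-1.
    by rewrite gt_min; apply/orP; right; lra.
  split; first by rewrite m0.
  have := hd (Num.min (d / 2) 4^-1); rewrite /ball/= sub0r normrN gtr0_norm//.
  have -> : Num.min (d / 2) 4^-1 < d by rewrite gt_min; apply/orP; left; lra.
  by move=> /(_ isT); rewrite distrC => /ltr_normlP[]; lra.
have /andP[r0 r1] := r_range.
have one : 0 <= (1 : R) <= 1 by rewrite lexx ler01.
have [n0 H] := achievability r_range one e2.
exists n0 => n /H[I [phi [h1 h2]]]; exists I, phi; split.
  apply: (le_trans h1); rewrite mul1r.
  have : g_rate q r < g_rate q 0 by apply: g_rate_decr => //; exact: ltW.
  by rewrite g_rate0; lra.
apply: le_trans h2; rewrite mul1r.
by move: hr; rewrite f_rel0; lra.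
Qed.

Lemma relevance_rate_critical Rc rate : critical_rate p q Rc -> 0 <= rate <= h2 q ->
  relevance_rate law rate =
    if rate <= Rc then 1 - h2 (bconv p q) + f_rel p q (ginv q Rc) / Rc * rate
    else 1 - h2 (bconv p q) + f_rel p q (ginv q rate).
Proof.
move=> [/andP[Rc0 Rc1]].
have Rc_range : 0 <= Rc <= h2 q by rewrite !ltW.
have [] := ginv_spec q_range Rc_range.
set rc := ginv q Rc => /andP[rc0 rc1] grc.
have {}rc0 : 0 < rc.
  rewrite lt_neqAle rc0 andbT; apply/eqP => e.
  by move: Rc1; rewrite -grc -e g_rate0 ltxx.
have {}rc1 : rc < 2^-1.
  rewrite lt_neqAle rc1 andbT; apply/eqP => e.
  by move: Rc0; rewrite -grc e (g_rate_half q) ltxx.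
have rc_range : 0 < rc < 2^-1 by rewrite rc0.
have rc01 : 0 < rc < 1 by rewrite rc0; lra.
have rc01' : 0 <= rc <= 1 by rewrite !ltW//; lra.
rewrite !derive1E (derive_val (is_derive := is_derive_f_rel p_range q_range rc01'))
  (derive_val (is_derive := is_derive_g_rate q_range rc01)) => crit.
have dg0 := dg_rate_lt0 q_range rc_range.
have frc0 : 0 < f_rel p q rc.
  rewrite -(f_rel_half p q); apply: f_rel_decr => //; exact: ltW.
set c := f_rel p q rc / Rc in crit *.
have c0 : 0 < c by rewrite divr_gt0.
have drc : df_rel p q rc = c * dg_rate q rc by rewrite -crit divfK// lt_eqF.
have Grc : f_rel p q rc - c * g_rate q rc = 0.
  by rewrite grc /c divfK ?gt_eqF// subrr.
move=> /andP[rate0 rate1].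
case: ifPn => [rRc|]; last rewrite -ltNge => Rcr.
(* Straight piece: coding a fraction rate/Rc of the letters at [rc] reaches the chord from the
   origin, which is also the tangent at [rc] and hence a majorant with M = 0. *)
- apply: relevance_rateE.
    have -> : c * rate = (rate / Rc) * f_rel p q rc by rewrite /c; field; rewrite gt_eqF.
    apply: achievable_point => //.
      by rewrite divr_ge0 ?(ltW Rc0)//= ler_pdivrMr// mul1r.
    by rewrite grc divfK// gt_eqF.
  move=> m hm.
  have H x : 0 <= x <= 1 -> f_rel p q x <= c * g_rate q x + 0.
    move=> x01; have := tangent_max p_range q_range c0 rc_range drc _ x01.
    by rewrite Grc lexx => /(_ isT); lra.
  by have := converse p_range q_range (ltW c0) H hm; rewrite addr0.
(* At rate h2(q) the parameter is r = 0, where g has no finite slope and the tangent argument does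
   not apply. *)
have [rE|rlt] := eqVneq rate (h2 q).
  rewrite relevance_rate_full; last by rewrite rE.
  have h20q : 0 <= h2 q <= h2 q by rewrite lexx (le_trans rate0).
  have [] := ginv_spec q_range h20q.
  rewrite rE; set z := ginv q (h2 q) => /andP[z0 z1] gz.
  have -> : z = 0.
    apply/eqP; rewrite eq_le z0 andbT leNgt; apply/negP => zp.
    by have := g_rate_decr q_range (lexx 0) zp z1; rewrite gz g_rate0 ltxx.
  by rewrite f_rel0; ring.
have {rlt rate1}rate1 : rate < h2 q by rewrite lt_neqAle rlt.
have rate_range : 0 <= rate <= h2 q by rewrite rate0 ltW.
have [] := ginv_spec q_range rate_range.
set r := ginv q rate => /andP[r0 r1] gr.
have {}r0 : 0 < r.
  rewrite lt_neqAle r0 andbT; apply/eqP => e.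
  by move: rate1; rewrite -gr -e g_rate0 ltxx.
have rrc : r < rc.
  rewrite ltNge; apply/negP; rewrite le_eqVlt => /predU1P[e|h].
    by move: Rcr; rewrite -gr -grc e ltxx.
  by have := g_rate_decr q_range (ltW rc0) h r1; rewrite gr grc ltNge (ltW Rcr).
have r_range : 0 < r < 2^-1 by rewrite r0; lra.
have rrc' : 0 < r < rc by rewrite r0.
have dgr := dg_rate_lt0 q_range r_range.
have dfr : df_rel p q r < 0 by apply: df_rel_lt0 => //; rewrite ltW//; lra.
(* The slope of the tangent at the given rate. It is at most [c], so the line of slope [c'] through
   the point of [rc] has nonnegative intercept; [tangent_intercept] passes this on to r, as
   [tangent_max] requires. *)
pose c' := df_rel p q r / dg_rate q r.
have c'0 : 0 < c' by rewrite /c' -divrNN divr_gt0 ?oppr_gt0.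
have drE : df_rel p q r = c' * dg_rate q r by rewrite /c' divfK// lt_eqF.
have c'c : c' <= c.
  have := tangent_slope p_range q_range c0 rc_range drc _ rrc'.
  by rewrite Grc lexx => /(_ isT); rewrite /c' ler_ndivrMr.
have Grc' : 0 <= f_rel p q rc - c' * g_rate q rc.
  rewrite -Grc lerD2l lerN2 ler_wpM2r// grc; exact: ltW.
have Gr := tangent_intercept p_range q_range c'0 rc_range drE rrc' Grc'.
apply: relevance_rateE.
  have -> : f_rel p q r = 1 * f_rel p q r by rewrite mul1r.
  by apply: achievable_point => //; rewrite ?lexx ?ler01// mul1r gr.
move=> m hm.
have H x : 0 <= x <= 1 -> f_rel p q x <= c' * g_rate q x + (f_rel p q r - c' * g_rate q r).
  by move=> x01; have := tangent_max p_range q_range c'0 r_range drE Gr x01; lra.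
by have := converse p_range q_range (ltW c'0) H hm; rewrite gr; lra.
Qed.

End CodingTheorem.

(** * From the random variables to the law of one letter *)

Section JointLaw.
Context {R : realType} {d : measure_display} {T : measurableType d}.
Variable P : probability T R.

Let bernoulli_mass a (U : {RV P >-> bool}) b : 0 <= a <= 1 -> bernoulli_rv a U ->
  P (U @^-1` [set b]) = (noise a b)%:E.
Proof.
move=> a01 Ua; have := Ua [set b]; rewrite /distribution/= /pushforward => ->.
rewrite bernoulli_probE// !diracE; case: b.
  by rewrite mem_set// memNset// mule1 mule0 adde0.
by rewrite memNset// mem_set// mule1 mule0 add0e.
Qed.

Lemma joint_pmf_source (p q : R) (X1 X2 Y Z W : {RV P >-> bool}) :
  0 <= p <= 1 -> 0 <= q <= 1 ->
  bernoulli_rv 2^-1 X2 -> bernoulli_rv q Z -> bernoulli_rv p W ->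
  (forall w, X1 w = X2 w (+) Z w) -> (forall w, Y w = X1 w (+) W w) ->
  independent_rv P Z X2 -> independent_rv P W (fun w => (X1 w, X2 w)) ->
  joint_pmf P X1 X2 Y = source_law p q.
Proof.
move=> p01 q01 X2b Zb Wb X1E YE ZX2 WX.
apply/funext => -[[a b] c]; rewrite /joint_pmf /source_law/=.
have -> : [set w | (X1 w, X2 w, Y w) = (a, b, c)] =
    W @^-1` [set a (+) c] `&` (fun w => (X1 w, X2 w)) @^-1` [set (a, b)].
  apply/seteqP; split => w /=.
    by move=> [<- <- <-]; rewrite YE addKb.
  by move=> [We [X1a X2b']]; rewrite YE We X1a X2b' addKb.
rewrite WX//; last first.
  have -> : [set (a, b)] = [set a] `*` [set b].
    by apply/seteqP; split => -[x y] /=; [case=> -> -> | case=> -> ->].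
  exact: measurableX.
have -> : (fun w => (X1 w, X2 w)) @^-1` [set (a, b)] =
    Z @^-1` [set a (+) b] `&` X2 @^-1` [set b].
  apply/seteqP; split => w /=.
    by move=> [<- <-]; rewrite X1E addbAC addbb.
  by move=> [Ze X2e]; rewrite X1E Ze X2e addbC -addbA addbb addbF.
rewrite ZX2// (bernoulli_mass _ p01 Wb) (bernoulli_mass _ q01 Zb).
rewrite (bernoulli_mass _ _ X2b); last by apply/andP; split; lra.
have -> : noise 2^-1 b = 2^-1 :> R by rewrite /noise; case: b => //; lra.
by rewrite -!EFinM/=; ring.
Qed.

End JointLaw.

Theorem theorem11 (R : realType) (d : measure_display) (T : measurableType d)
    (P : probability T R) (p q : R) (X1 X2 Y Z W : {RV P >-> bool})
    (p_range : 0 < p < 2^-1) (q_range : 0 < q < 2^-1)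
    (X1_bern : bernoulli_rv 2^-1 X1)
    (X2_bern : bernoulli_rv 2^-1 X2)
    (Y_bern : bernoulli_rv 2^-1 Y)
    (X2_X1_Y_markov : markov_chain P X2 X1 Y)
    (X1E : forall w, X1 w = X2 w (+) Z w)
    (Z_bern : bernoulli_rv q Z)
    (Z_indep : independent_rv P Z X2)
    (YE : forall w, Y w = X1 w (+) W w)
    (W_bern : bernoulli_rv p W)
    (W_indep : independent_rv P W (fun w => (X1 w, X2 w))) :
  let muD := relevance_rate (joint_pmf P X1 X2 Y) in
  (forall Rc : R, critical_rate p q Rc ->
     forall rate : R, 0 <= rate <= h2 q ->
       muD rate =
         if rate <= Rc
         then 1 - h2 (bconv p q) + f_rel p q (ginv q Rc) / Rc * rate
         else 1 - h2 (bconv p q) + f_rel p q (ginv q rate)) /\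
  (forall rate : R, h2 q < rate -> muD rate = 1 - h2 p).
Proof.
have p01 : 0 <= p <= 1 by move: p_range => /andP[/ltW -> ?]/=; lra.
have q01 : 0 <= q <= 1 by move: q_range => /andP[/ltW -> ?]/=; lra.
rewrite (joint_pmf_source p01 q01 X2_bern Z_bern W_bern X1E YE Z_indep W_indep) /=.
split=> [Rc crit rate hrate|rate hrate].
  exact: relevance_rate_critical.
by apply: relevance_rate_full => //; exact: ltW.
Qed.
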